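(* Let $m>7/2$. There is a constant $C_m$ depending only on $m$ such that for every compactly supported radial five-dimensional density $F^2\in L^1(\mathbb R^5)$, $$\|\partial_z(F^2)\|_{H^{-m}(\mathbb R^5)}\le C_m\|F^2\|_{L^1(\mathbb R^5)}.$$
   Context: Points of $\mathbb R^5$ are written $(y,z)\in\mathbb R^4\times\mathbb R$; ''radial'' means that $F$ depends only on $(|y|,z)$. $\partial_z(F^2)$ is the distributional derivative, and $H^{-m}(\mathbb R^5)$ is the dual of the Sobolev space $H^m(\mathbb R^5)$. *)

(* Defs.v *)
From HB Require Import structures.
From mathcomp Require Import all_boot all_order all_algebra.
From mathcomp Require Import all_classical all_reals all_analysis.

Set Implicit Arguments.
Unset Strict Implicit.
Unset Printing Implicit Defensive.
Import Order.TTheory GRing.Theory Num.Theory.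
Import numFieldNormedType.Exports.
Local Open Scope classical_set_scope.
Local Open Scope ring_scope.

Notation R4 R := (R * R * R * R)%type.
Notation R5 R := (R4 R * R)%type.

                                                                               
                                                                              
Definition dot4 (R : realType) (y y' : R4 R) : R :=
  let: (a1, a2, a3, a4) := y in let: (b1, b2, b3, b4) := y' in
  a1 * b1 + a2 * b2 + a3 * b3 + a4 * b4.

Definition dot5 (R : realType) (x x' : R5 R) : R :=
  dot4 x.1 x'.1 + x.2 * x'.2.

Definition norm4 (R : realType) (y : R4 R) : R := Num.sqrt (dot4 y y).
Definition norm5 (R : realType) (x : R5 R) : R := Num.sqrt (dot5 x x).

                                                                  
Notation mR5 R := (measurableTypeR R * measurableTypeR R * measurableTypeR R *
  measurableTypeR R * measurableTypeR R)%type.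

Definition leb5 (R : realType) : {measure set (mR5 R) -> \bar R} :=
  ((((@lebesgue_measure R \x @lebesgue_measure R) \x @lebesgue_measure R)
     \x @lebesgue_measure R) \x @lebesgue_measure R)%E.

Definition radial (R : realType) (F : R5 R -> R) : Prop :=
  exists f : R -> R -> R, forall (y : R4 R) (z : R), F (y, z) = f (norm4 y) z.

Definition compactly_supported (R : realType) (F : R5 R -> R) : Prop :=
  compact (closure [set x | F x != 0]).

Definition iter_derive (R : realType) (s : seq (R5 R)) (f : R5 R -> R) :
  R5 R -> R := foldr (fun v g => 'D_v g) f s.

Definition smooth (R : realType) (f : R5 R -> R) : Prop :=
  forall s : seq (R5 R), continuous (iter_derive s f) /\
    forall x v, derivable (iter_derive s f) x v.

Definition test_function (R : realType) (phi : R5 R -> R) : Prop :=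
  smooth phi /\ compactly_supported phi.

                                                                              
                                        
Definition distribution (R : realType) := (R5 R -> R) -> R.

Definition regular_distribution (R : realType) (f : R5 R -> R) :
  distribution R := fun phi => Rintegral (@leb5 R) setT (fun x => f x * phi x).

Definition distr_derive (R : realType) (v : R5 R) (T : distribution R) :
  distribution R := fun phi => - T ('D_v phi).

Definition distr_dz (R : realType) (T : distribution R) : distribution R :=
  distr_derive ((0, 1) : R5 R) T.

                                                                     
Definition fourier_L1 (R : realType) (f : R5 R -> R) (xi : R5 R) : R * R :=
  (Rintegral (@leb5 R) setT (fun x => f x * cos (2 * pi * dot5 x xi)),
   - Rintegral (@leb5 R) setT (fun x => f x * sin (2 * pi * dot5 x xi))).

Definition truncate (R : realType) (n : nat) (u : R5 R -> R) (x : R5 R) : R :=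
  if norm5 x <= n%:R then u x else 0.

Definition sqmod (R : realType) (w : R * R) : R := w.1 ^+ 2 + w.2 ^+ 2.

                                                                                
                                                           
Definition is_fourier_L2 (R : realType) (u : R5 R -> R) (U : R5 R -> R * R) :
  Prop :=
  measurable_fun (setT : set (mR5 R)) U /\
  (fun n => \int[@leb5 R]_xi
     (sqmod (fourier_L1 (truncate n u) xi - U xi))%:E)%E @ \oo --> 0%E.

                                                                              
                                    
Definition sobolev_weighted (R : realType) (m : R) (U : R5 R -> R * R) : \bar R :=
  ((\int[@leb5 R]_xi
     ((1 + norm5 xi ^+ 2) `^ m * sqmod (U xi))%:E) `^ (2^-1))%E.

                                                                       
                         
Definition sobolev (R : realType) (m : R) : set (R5 R -> R) :=
  [set u | u \in Lfun (@leb5 R) 2%:E /\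
     exists2 U, is_fourier_L2 u U & (sobolev_weighted m U < +oo)%E].

                                                                               
                 
Definition sobolev_norm (R : realType) (m : R) (u : R5 R -> R) : \bar R :=
  sobolev_weighted m (xget (fun=> (0, 0)) [set U | is_fourier_L2 u U]).

Definition sobolev_linear (R : realType) (m : R) (L : (R5 R -> R) -> R) : Prop :=
  forall (a : R) (u v : R5 R -> R), sobolev m u -> sobolev m v ->
    L (fun x => a * u x + v x) = a * L u + L v.

Definition dual_norm (R : realType) (m : R) (L : (R5 R -> R) -> R) : \bar R :=
  ereal_sup [set (`|L u|)%:E | u in
    [set u | sobolev m u /\ (sobolev_norm m u <= 1)%E]].

                                                                             
                                                                               
                                                                                 
                                                                                
                                        
Definition neg_sobolev_norm (R : realType) (m : R) (T : distribution R) : \bar R :=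
  ereal_inf [set dual_norm m L | L in
    [set L | sobolev_linear m L /\ forall phi, test_function phi -> L phi = T phi]].

(* Main.v *)
Require Import Defs.
From HB Require Import structures.
From mathcomp Require Import all_boot all_order all_algebra.
From mathcomp Require Import all_classical all_reals all_analysis.
From mathcomp Require Import measurable_realfun ring lra.

Set Implicit Arguments.
Unset Strict Implicit.
Unset Printing Implicit Defensive.
Import Order.TTheory GRing.Theory Num.Theory.
Import numFieldNormedType.Exports.
Local Open Scope classical_set_scope.
Local Open Scope ring_scope.

(** If m > 7/2, then |xi|^2 (1 + |xi|^2)^(-m) is integrable on R^5, so by
Cauchy-Schwarz (in the form of AM-GM) xi_z times the Fourier transform of a
function of unit H^m norm has an L^1 norm bounded by a constant. The extension
of d_z(f), f = F^2, to H^m is therefore the pairing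
  u |-> int 2 pi xi_z (Re U(xi) int f sin(2 pi x.xi) dx
                       + Im U(xi) int f cos(2 pi x.xi) dx) dxi,
where U is the Fourier transform of u, and the transform of f is at most |f|_1.
On test functions it agrees with d_z(f) by the identity
int f g = int (conj f^) g^ applied to g = d_z phi, which holds for f in L^1 and g
bounded and continuous with g and g^ in L^1; it follows from Fubini by
regularizing with the weight exp(-e sum |xi_i|), whose Fourier transform is a
product of Poisson kernels. *)

(** The threshold 7/2 comes from |xi_z|^2 (1 + |xi|^2)^(-m) <= (1 + |xi|^2)^(-(m-1)), whose right
    side is integrable on R^5 when m - 1 > 5/2. Since f is only in L^1, f^ is merely bounded, so all
    decay on the frequency side must come from g^. The weight exp(-e sum |xi_i|) is chosen because
    it splits into one-variable factors whose transforms have elementary antiderivatives. Its price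
    is the slow tail 1/t^2 of the Poisson kernel, against which t^2 is not integrable; the bounded
    function t^2 / (1 + t^2) measures distance instead. A second difficulty is that [is_fourier_L2]
    determines the transform only up to a null set, while [sobolev_norm] evaluates a chosen one.
    Almost everywhere uniqueness makes the pairing independent of the choice, makes it linear in u,
    and lets the integral formula replace the chosen transform of a test function. The negative norm
    is an infimum over linear extensions, so one such functional is enough. *)

Local Notation intR mu f := (mu.-integrable setT (EFin \o (f : _ -> _))).

(** * Sigma-finiteness of product measures *)

Section product_measure_sigma_finite.
Context d1 d2 (T1 : measurableType d1) (T2 : measurableType d2) (R : realType).
Variable m1 : {sigma_finite_measure set T1 -> \bar R}.
Variable m2 : {sigma_finite_measure set T2 -> \bar R}.

(** This lets products be iterated, up to R^5 x R^5, with Fubini available at each stage. *)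
Lemma product_measure1_sigma_finite : sigma_finite setT (m1 \x m2)%E.
Proof.
have [F TF Ffin] := sigma_finiteT m1; have [G TG Gfin] := sigma_finiteT m2.
(* The default pair for undecodable k is harmless: [pickleK] shows that every pair of indices is
   reached. *)
pose p k : nat * nat := odflt (0, 0)%N (unpickle k).
exists (fun k => F (p k).1 `*` G (p k).2).
  apply/seteqP; split=> // -[x y] _.
  have [i _ Fx] : (\bigcup_i F i) x by rewrite -TF.
  have [j _ Gy] : (\bigcup_j G j) y by rewrite -TG.
  by exists (pickle (i, j)) => //; rewrite /p pickleK.
move=> k; have [mF F_fin] := Ffin (p k).1; have [mG G_fin] := Gfin (p k).2.
split; first exact: measurableX.
by rewrite product_measure1E// lte_mul_pinfty// ge0_fin_numE.
Qed.

Definition sigma_finite_prod : set (T1 * T2) -> \bar R := (m1 \x m2)%E.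
HB.instance Definition _ := Measure.on sigma_finite_prod.
HB.instance Definition _ := Measure_isSigmaFinite.Build _ _ _ sigma_finite_prod
  product_measure1_sigma_finite.

End product_measure_sigma_finite.

(** * Integrability of real-valued functions *)

Section real_integrable.
Context d (T : measurableType d) (R : realType).
Variable mu : {measure set T -> \bar R}.
Implicit Types f g h : T -> R.

Lemma integrableR_measurable f : intR mu f -> measurable_fun setT f.
Proof. by move=> /measurable_int /measurable_EFinP. Qed.

Lemma integrableR_le g f : measurable_fun setT f -> intR mu g ->
  (forall x, `|f x| <= g x) -> intR mu f.
Proof.
move=> mf ig fg; apply: le_integrable ig => //; first exact/measurable_EFinP.
by move=> x _; rewrite /= lee_fin (le_trans (fg x))// ler_norm.
Qed.

Lemma integrableRD f g : intR mu f -> intR mu g -> intR mu (fun x => f x + g x).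
Proof.
by move=> mf mg; rewrite (_ : _ \o _ = (EFin \o f) \+ (EFin \o g))%E//; exact: integrableD.
Qed.

Lemma integrableRZ (k : R) f : intR mu f -> intR mu (fun x => k * f x).
Proof.
by move=> mf; rewrite (_ : _ \o _ = fun x => k%:E * (EFin \o f) x)%E//; exact: integrableZl.
Qed.

Lemma integrableR_norm f : intR mu f -> intR mu (fun x => `|f x|).
Proof. by move=> mf; exact: (integrable_norm mf). Qed.

Lemma integrableRM (M : R) f h : intR mu f -> measurable_fun setT h ->
  (forall x, `|h x| <= M) -> intR mu (fun x => f x * h x).
Proof.
move=> mf mh hM.
apply: (@integrableR_le (fun x => M * `|f x|)).
- by apply: measurable_funM => //; exact: integrableR_measurable.
- by apply: integrableRZ; exact: integrableR_norm.
- by move=> x; rewrite normrM mulrC ler_wpM2r.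
Qed.

Lemma dominated_cvg_Rintegral (f_ : nat -> T -> R) f g :
  (forall n, measurable_fun setT (f_ n)) ->
  (forall x, f_ n x @[n --> \oo] --> f x) -> intR mu g ->
  (forall n x, `|f_ n x| <= g x) ->
  (\int[mu]_x (f_ n x)) @[n --> \oo] --> \int[mu]_x (f x).
Proof.
move=> mf ff ig fg.
have mlim : measurable_fun setT f by apply: (measurable_fun_cvg mf) => x _; exact: ff.
have fle x : `|f x| <= g x.
  by apply: ler_cvg_to (cvg_norm (ff x)) (cvg_cst (g x)) _; exact: nearW.
apply: fine_cvg; rewrite /Rintegral fineK; last first.
  by apply: integrable_fin_num => //; exact: (@integrableR_le g).
apply: (@dominated_cvg _ _ _ _ _ _ _ _ (EFin \o g)) => //=.
- by move=> n; exact/measurable_EFinP.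
- by move=> x _; apply: cvg_EFin; [exact: nearW | exact: ff].
- by move=> n x _; rewrite lee_fin.
Qed.

(** An integrable function is finite almost everywhere, so [fine] changes it on a null set only.
    Inner integrals in Fubini are a priori extended reals; this brings them back to R. *)
Lemma integrableR_fine (F : T -> \bar R) : mu.-integrable setT F ->
  intR mu (fine \o F) /\ (\int[mu]_x F x = \int[mu]_x (fine (F x))%:E)%E.
Proof.
move=> iF.
have aeF : ae_eq mu setT F (EFin \o (fine \o F)).
  have := integrable_ae measurableT iF; apply: filterS => x /(_ I) Fx _.
  by rewrite /= fineK.
have mF := measurable_int _ iF.
have mfF : measurable_fun setT (EFin \o (fine \o F)).
  by apply/measurable_EFinP; apply: measurableT_comp => //; exact: fine_measurable.
split; last by apply: ae_eq_integral.
apply: le_integrable iF => //= x _.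
by case: (F x) => //=; rewrite normr0 leey.
Qed.

End real_integrable.

(** * Fubini's theorem for real-valued integrals *)

Section fubini.
Context d1 d2 (T1 : measurableType d1) (T2 : measurableType d2) (R : realType).
Variable m1 : {sigma_finite_measure set T1 -> \bar R}.
Variable m2 : {sigma_finite_measure set T2 -> \bar R}.
Let m12 := sigma_finite_prod m1 m2.

Lemma measurable_fst_comp d (T : measurableType d) (f : T1 -> T) :
  measurable_fun setT f -> measurable_fun [set: T1 * T2] (fun z => f z.1).
Proof. by move=> mf; apply: measurableT_comp => //; exact: measurable_fst. Qed.

Lemma measurable_snd_comp d (T : measurableType d) (f : T2 -> T) :
  measurable_fun setT f -> measurable_fun [set: T1 * T2] (fun z => f z.2).
Proof. by move=> mf; apply: measurableT_comp => //; exact: measurable_snd. Qed.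

Lemma Rintegral_fubini (f : T1 * T2 -> R) : intR m12 f ->
  intR m1 (fun x => \int[m2]_y (f (x, y))) /\
  \int[m12]_z (f z) = \int[m1]_x (\int[m2]_y (f (x, y))).
Proof.
move=> if_.
have [iF eF] := integrableR_fine (@integrable_fubini_F _ _ _ _ _ m1 m2 _ if_).
split=> //; rewrite {1}/Rintegral -(@integral12_prod_meas1 _ _ _ _ _ m1 m2 _ if_).
by rewrite eF.
Qed.

(** By Tonelli the integral of |A(x) B(y)| is a product of two finite numbers. *)
Lemma integrableR_prod (A : T1 -> R) (B : T2 -> R) : intR m1 A -> intR m2 B ->
  intR m12 (fun z => A z.1 * B z.2).
Proof.
move=> iA iB; have mA := integrableR_measurable iA; have mB := integrableR_measurable iB.
have mABR : measurable_fun [set: T1 * T2] (fun z => A z.1 * B z.2).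
  by apply: measurable_funM; [exact: measurable_fst_comp | exact: measurable_snd_comp].
have mAB := (measurable_EFinP _ _).2 mABR.
apply/(integrable12ltyP m1 m2 mAB).
have mnA : measurable_fun setT (fun x => `|A x|%:E).
  by apply/measurable_EFinP; exact: measurableT_comp.
have mnB : measurable_fun setT (fun x => `|B x|%:E).
  by apply/measurable_EFinP; exact: measurableT_comp.
have iB1 : (\int[m2]_y `|B y|%:E)%E \is a fin_num.
  by apply: integrable_fin_num => //; exact: integrableR_norm.
have iA1 : (\int[m1]_x `|A x|%:E)%E \is a fin_num.
  by apply: integrable_fin_num => //; exact: integrableR_norm.
rewrite (_ : (\int[m1]_x _)%E = (\int[m1]_x (`|A x|%:E * \int[m2]_y `|B y|%:E))%E).
  rewrite ge0_integralZr// ?integral_ge0//.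
  by rewrite -(fineK iA1) -(fineK iB1) -EFinM ltry.
apply: eq_integral => x _; rewrite -ge0_integralZl//.
by apply: eq_integral => y _; rewrite /= normrM EFinM.
Qed.

Lemma Rintegral_prod (A : T1 -> R) (B : T2 -> R) : intR m1 A -> intR m2 B ->
  \int[m12]_z (A z.1 * B z.2) = (\int[m1]_x (A x)) * \int[m2]_y (B y).
Proof.
move=> iA iB; rewrite (Rintegral_fubini (integrableR_prod iA iB)).2 /=.
rewrite -RintegralZr//; apply: eq_Rintegral => x _.
by rewrite RintegralZl.
Qed.

(** The inner integral is the difference of those of the positive and negative parts, each
    measurable by Tonelli. *)
Lemma measurable_Rintegral (f : T1 * T2 -> R) : measurable_fun setT f ->
  measurable_fun setT (fun x => \int[m2]_y (f (x, y))).
Proof.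
move=> mf; apply: measurableT_comp; first exact: fine_measurable.
have mF : measurable_fun setT (EFin \o f) by exact/measurable_EFinP.
rewrite (_ : (fun x => (\int[m2]_y (f (x, y))%:E)%E) =
  (fun x => fubini_F m2 (EFin \o f)^\+ x - fubini_F m2 (EFin \o f)^\- x)%E); last first.
  apply/funext => x; rewrite integralE /fubini_F.
  by congr (_ - _)%E; apply: eq_integral => y _; rewrite ?funeposE ?funenegE.
apply: emeasurable_funB.
  by apply: measurable_fun_fubini_tonelli_F => //; exact: measurable_funepos.
by apply: measurable_fun_fubini_tonelli_F => //; exact: measurable_funeneg.
Qed.

(** The function M |A(x)| |B(y)| is an integrable majorant, so a bounded coupling c may be
    integrated in either order. *)
Lemma Rintegral_exchange (M : R) (A : T1 -> R) (B : T2 -> R) (c : T1 * T2 -> R) :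
  intR m1 A -> intR m2 B -> measurable_fun setT c -> (forall z, `|c z| <= M) ->
  \int[m1]_x (A x * \int[m2]_y (B y * c (x, y))) =
  \int[m2]_y (B y * \int[m1]_x (A x * c (x, y))).
Proof.
move=> iA iB mc cM.
have iAB := integrableR_prod iA iB.
have iABc := integrableRM iAB mc cM.
have icx x : intR m2 (fun y => B y * c (x, y)).
  apply: (integrableRM (M := M) iB) => // .
  by apply: measurableT_comp => //; exact: pair1_measurable.
have icy y : intR m1 (fun x => A x * c (x, y)).
  apply: (integrableRM (M := M) iA) => //.
  by apply: measurableT_comp => //; exact: pair2_measurable.
transitivity (\int[m12]_z (A z.1 * B z.2 * c z)).
  rewrite (Rintegral_fubini iABc).2; apply: eq_Rintegral => x _ /=.
  by rewrite -RintegralZl//; apply: eq_Rintegral => y _; rewrite mulrA.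
rewrite {1}/Rintegral -(@integral21_prod_meas1 _ _ _ _ _ m1 m2 _ iABc) /fubini_G /=.
congr fine; apply: eq_integral => y _ /=.
rewrite /Rintegral EFinM fineK; last exact: (integrable_fin_num _ (icy y)).
rewrite -(integralZl _ (icy y))//; apply: eq_integral => x _.
by rewrite /= -EFinM mulrA (mulrC (A x)).
Qed.

End fubini.

(** * Explicit integrals on the real line *)

Section line.
Variable R : realType.
Local Notation leb := (@lebesgue_measure R).
Implicit Types f F : R -> R.

Lemma ge0_FTC_half_line f F (l : R) : (forall x : R, is_derive x 1 F (f x)) -> continuous f ->
  (forall x, 0 <= x -> 0 <= f x) -> F x @[x --> +oo] --> l ->
  (\int[leb]_(x in `[0%R, +oo[) (f x)%:E = (l - F 0)%:E)%E.
Proof.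
move=> dF cf f0 Fl.
have cF : continuous F.
  by move=> x; apply/differentiable_continuous/derivable1_diffP; case: (dF x).
rewrite (ge0_continuous_FTC2y f0 _ Fl)//.
- exact: continuous_subspaceT.
- exact: (cvg_at_right_filter (cF 0)).
- by move=> x _; rewrite derive1E; apply: derive_val.
Qed.

Lemma ge0_integral_line f : continuous f -> (forall x, 0 <= f x) ->
  (\int[leb]_x (f x)%:E = \int[leb]_(x in `[0%R, +oo[) (f x)%:E
    + \int[leb]_(x in `[0%R, +oo[) (f (- x))%:E)%E.
Proof.
move=> cf f0; have mf : measurable_fun setT f by exact: continuous_measurable_fun.
have mEf : measurable_fun setT (EFin \o f) by exact/measurable_EFinP.
have mI : measurable (`[(0 : R), +oo[%classic : set R) by exact: measurable_itv.
rewrite -(setUv (`[(0 : R), +oo[%classic : set R)) ge0_integral_setU//; last 4 first.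
- exact: measurableC.
- by rewrite setUv.
- by move=> x _; rewrite lee_fin.
- exact/disj_setPCl.
congr (_ + _)%E; rewrite setCitvr.
(* Adding the null point 0 makes the negative half line the mirror image of [[0, +oo[]. *)
rewrite integral_itv_bndo_bndc; last exact: measurable_funTS.
rewrite (@ge0_integration_by_substitution0 _ (fun x => (f (- x))%:E)).
- by apply: eq_integral => x _; rewrite opprK.
- by apply/measurable_EFinP; apply: measurableT_comp => //.
- by move=> r; rewrite lee_fin.
Qed.

(** The integrands in view contain |t| and have no single smooth formula. Hence f is described by f1
    on the right and, after reflection, by f2 on the left. As f is nonnegative, the finite value of
    the integral also proves integrability. *)
Lemma FTC_line f f1 f2 F1 F2 (l1 l2 : R) : continuous f -> (forall x, 0 <= f x) ->
  continuous f1 -> continuous f2 ->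
  (forall x : R, is_derive x 1 F1 (f1 x)) -> (forall x : R, is_derive x 1 F2 (f2 x)) ->
  (forall x, 0 <= x -> f x = f1 x) -> (forall x, 0 <= x -> f (- x) = f2 x) ->
  F1 x @[x --> +oo] --> l1 -> F2 x @[x --> +oo] --> l2 ->
  intR leb f /\ \int[leb]_x (f x) = (l1 - F1 0) + (l2 - F2 0).
Proof.
move=> cf f0 cf1 cf2 dF1 dF2 ff1 ff2 Fl1 Fl2.
have e : (\int[leb]_x (f x)%:E = ((l1 - F1 0) + (l2 - F2 0))%:E)%E.
  rewrite ge0_integral_line// EFinD; congr (_ + _)%E.
    rewrite -(ge0_FTC_half_line dF1)//; last by move=> x x0; rewrite -ff1.
    by apply: eq_integral => x; rewrite inE/= in_itv/= andbT => /ff1 ->.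
  rewrite -(ge0_FTC_half_line dF2)//; last by move=> x x0; rewrite -ff2.
  by apply: eq_integral => x; rewrite inE/= in_itv/= andbT => /ff2 ->.
split; last by rewrite /Rintegral e.
apply/integrableP; split.
  by apply/measurable_EFinP; exact: continuous_measurable_fun.
suff -> : (\int[leb]_x `|(EFin \o f) x| = \int[leb]_x (f x)%:E)%E by rewrite e ltry.
by apply: eq_integral => x _; rewrite /= ger0_norm.
Qed.

Lemma cvgy_scale_comp (T : topologicalType) (h : R -> T) (a b : R) (l : T) : 0 < a ->
  h x @[x --> +oo] --> l -> h (a * x + b) @[x --> +oo] --> l.
Proof.
move=> a0 hl; apply: (cvg_comp (fun x => a * x + b) h) hl.
apply/cvgryPge => A; near=> x.
have : (A - b) / a <= x by near: x; apply: nbhs_pinfty_ge; rewrite num_real.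
by rewrite ler_pdivrMr// lerBlDr mulrC.
Unshelve. all: by end_near. Qed.

(** The summand 1 next to the cosine keeps the integrand nonnegative, as [FTC_line] requires; its
    contribution is subtracted in [integral_exp_weight_cos]. The phase c lets one computation serve
    cosine (c = 0) and sine (c = - pi / 2). *)
Lemma exp_cos_derive (e b c x : R) : 0 < e ->
  is_derive x 1 (fun y => - expR (- e * y) / e +
     expR (- e * y) * (b * sin (b * y + c) - e * cos (b * y + c)) / (e ^+ 2 + b ^+ 2))
   (expR (- e * x) * (1 + cos (b * x + c))).
Proof.
move=> e0.
apply: is_derive_eq; rewrite /GRing.scale /=.
have : e != 0 by rewrite gt_eqF.
have : e ^+ 2 + b ^+ 2 != 0 by rewrite gt_eqF// ltr_wpDr ?sqr_ge0// exprn_gt0.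
move=> h1 h2; field.
by rewrite h1 h2.
Qed.

Lemma exp_cos_cvg (e b c : R) : 0 < e ->
  - expR (- e * x) / e +
     expR (- e * x) * (b * sin (b * x + c) - e * cos (b * x + c)) / (e ^+ 2 + b ^+ 2)
   @[x --> +oo] --> (0 : R).
Proof.
move=> e0.
have D : 0 < e ^+ 2 + b ^+ 2 by rewrite ltr_wpDr ?sqr_ge0// exprn_gt0.
(* K bounds the coefficient of [expR (- e * x)], since |sin| and |cos| are at most 1. *)
pose K := e^-1 + (`|b| + e) / (e ^+ 2 + b ^+ 2).
have c0 : K * expR (- (e * x + 0)) @[x --> +oo] --> (0 : R).
  rewrite -(mulr0 K); apply: cvgM (cvg_cst K) _.
  by apply: (cvgy_scale_comp (h := fun x => expR (- x))) => //; exact: cvgr_expR.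
apply/norm_cvg0P; apply: (squeeze_cvgr _ (cvg_cst 0) c0).
near=> x; rewrite normr_ge0 /= /K addr0 mulNr mulrDl.
rewrite (le_trans (ler_normD _ _))// lerD//.
  by rewrite mulNr normrN normrM !ger0_norm ?expR_ge0 ?invr_ge0 ?(ltW e0)// mulrC.
rewrite !normrM normfV (gtr0_norm D) (ger0_norm (expR_ge0 _)).
rewrite [leRHS]mulrC mulrA ler_wpM2r ?invr_ge0 ?(ltW D)// -(mulNr e x) ler_wpM2l ?expR_ge0//.
rewrite (le_trans (ler_normB _ _))// lerD// normrM.
  by rewrite ler_piMr// ler_norml sin_geN1 sin_le1.
by rewrite (gtr0_norm e0) ler_piMr ?(ltW e0)// ler_norml cos_geN1 cos_le1.
Unshelve. all: by end_near. Qed.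

Lemma continuous_exp_cos (e b c : R) :
  continuous (fun x => expR (- e * x) * (1 + cos (b * x + c))).
Proof.
move=> x; apply: cvgM; first by apply: continuous_comp;
  [apply: cvgM; [exact: cvg_cst | exact: cvg_id] | exact: continuous_expR].
apply: cvgD; first exact: cvg_cst.
apply: continuous_comp; last exact: continuous_cos.
by apply: cvgD; [apply: cvgM; [exact: cvg_cst | exact: cvg_id] | exact: cvg_cst].
Qed.

(** Reflection replaces c by - c on the negative half line, so in the sum of the two boundary values
    at 0 the sines cancel. *)
Lemma integral_expN_cos (e b c : R) : 0 < e ->
  intR leb (fun t => expR (- e * `|t|) * (1 + cos (b * t + c))) /\
  \int[leb]_t (expR (- e * `|t|) * (1 + cos (b * t + c))) =
    2 / e + 2 * e * cos c / (e ^+ 2 + b ^+ 2).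
Proof.
move=> e0.
have D : 0 < e ^+ 2 + b ^+ 2 by rewrite ltr_wpDr ?sqr_ge0// exprn_gt0.
have cf : continuous (fun t => expR (- e * `|t|) * (1 + cos (b * t + c))).
  move=> x; apply: cvgM; last first.
    apply: cvgD; first exact: cvg_cst.
    apply: continuous_comp; last exact: continuous_cos.
    by apply: cvgD; [apply: cvgM; [exact: cvg_cst | exact: cvg_id] | exact: cvg_cst].
  apply: continuous_comp; last exact: continuous_expR.
  by apply: cvgM; [exact: cvg_cst | exact: norm_continuous].
have f0 t : 0 <= expR (- e * `|t|) * (1 + cos (b * t + c)).
  by rewrite mulr_ge0 ?expR_ge0// -lerBlDl sub0r cos_geN1.
have := FTC_line cf f0 (@continuous_exp_cos e b c) (@continuous_exp_cos e b (- c))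
  (fun x => exp_cos_derive b c x e0) (fun x => exp_cos_derive b (- c) x e0) _ _
  (@exp_cos_cvg e b c e0) (@exp_cos_cvg e b (- c) e0).
move=> []; first by move=> x x0; rewrite ger0_norm.
- by move=> x x0; rewrite normrN ger0_norm// mulrN -[in RHS]cosN opprD opprK.
move=> h ->; split=> //; rewrite mulr0 expR0 mulr0 !add0r sinN cosN.
have h1 : e != 0 by rewrite gt_eqF.
have h2 : e ^+ 2 + b ^+ 2 != 0 by rewrite gt_eqF.
by field; rewrite h1 h2.
Qed.

Definition exp_weight (e t : R) := expR (- e * `|t|).
(** The half-plane Poisson kernel at height e / (2 pi). *)
Definition poisson (e t : R) := 2 * e / (e ^+ 2 + (2 * pi * t) ^+ 2).

Lemma integrable_exp_weight (e : R) : 0 < e -> intR leb (exp_weight e).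
Proof.
move=> e0; have [h _] := integral_expN_cos 0 0 e0.
have := integrableRZ 2^-1 h; congr (_.-integrable _ (EFin \o _)).
by apply/funext => t; rewrite mul0r add0r cos0 mulrC -mulrA divff ?mulr1.
Qed.

Lemma Rintegral_exp_weight (e : R) : 0 < e -> \int[leb]_t (exp_weight e t) = 2 / e.
Proof.
move=> e0; have [h] := integral_expN_cos 0 0 e0.
under eq_Rintegral => t _ do rewrite mul0r add0r cos0 mulrC.
rewrite RintegralZl//; last exact: integrable_exp_weight.
rewrite cos0 => h1.
have : 2 * (\int[leb]_t (exp_weight e t)) = 2 * (2 / e).
  rewrite h1 expr0n addr0 mulr1 expr2.
  have h2 : e != 0 by rewrite gt_eqF.
  by field.
by move/mulfI; apply.
Qed.

Lemma measurable_cos_affine (b c : R) : measurable_fun setT (fun t => cos (b * t + c)).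
Proof.
apply: continuous_measurable_fun => x.
apply: continuous_comp; last exact: continuous_cos.
by apply: cvgD; [apply: cvgM; [exact: cvg_cst | exact: cvg_id] | exact: cvg_cst].
Qed.

Lemma integral_exp_weight_cos (e b c : R) : 0 < e ->
  \int[leb]_t (exp_weight e t * cos (b * t + c)) = 2 * e * cos c / (e ^+ 2 + b ^+ 2).
Proof.
move=> e0; have [h] := integral_expN_cos b c e0.
under eq_Rintegral => t _ do rewrite mulrDr mulr1.
rewrite RintegralD//; [|exact: integrable_exp_weight|]; last first.
  apply: (integrableRM (M := 1) (integrable_exp_weight e0)); first exact: measurable_cos_affine.
  by move=> x; rewrite ler_norml cos_geN1 cos_le1.
by rewrite [X in X + _ = _](Rintegral_exp_weight e0) => /addrI.
Qed.

Lemma Rintegral_exp_weight_cos (e a : R) : 0 < e ->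
  \int[leb]_t (exp_weight e t * cos (2 * pi * (a * t))) = poisson e a.
Proof.
move=> e0; have := integral_exp_weight_cos (2 * pi * a) 0 e0.
rewrite cos0 mulr1 -/(poisson e a) => <-; apply: eq_Rintegral => t _.
by rewrite addr0 mulrA.
Qed.

(** The phase c = - pi / 2 turns the cosine into a sine, and the value of the integral is
    proportional to cos c = 0. *)
Lemma Rintegral_exp_weight_sin (e a : R) : 0 < e ->
  \int[leb]_t (exp_weight e t * sin (2 * pi * (a * t))) = 0.
Proof.
move=> e0; have := integral_exp_weight_cos (2 * pi * a) (- (pi / 2)) e0.
rewrite cosN cos_pihalf mulr0 mul0r => <-; apply: eq_Rintegral => t _.
by rewrite -!mulrA cosBpihalf.
Qed.

Lemma poisson_derive (e a x : R) : 0 < e ->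
  is_derive x 1 (fun y => atan (2 * pi / e * y + 2 * pi / e * a) / pi)
   (poisson e (x + a)).
Proof.
move=> e0; apply: is_derive_eq; rewrite /GRing.scale /= /poisson.
have h1 : e != 0 by rewrite gt_eqF.
have h2 : (pi : R) != 0 by rewrite gt_eqF// pi_gt0.
have D1 : e ^+ 2 + (2 * pi * (x + a)) ^+ 2 != 0.
  by rewrite gt_eqF// ltr_wpDr ?sqr_ge0// exprn_gt0.
move: (@pi R) h2 D1 => p h2 D1.
have -> : 1 + (2 * p / e * x + 2 * p / e * a) ^+ 2 =
    (e ^+ 2 + (2 * p * (x + a)) ^+ 2) / e ^+ 2 by field.
by field; rewrite h1 h2 D1.
Qed.

Lemma continuous_poisson (e a : R) : 0 < e -> continuous (fun x => poisson e (x + a)).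
Proof.
move=> e0 x; apply: cvgM; first exact: cvg_cst.
apply: cvgV; first by rewrite gt_eqF// ltr_wpDr ?sqr_ge0// exprn_gt0.
apply: cvgD; first exact: cvg_cst.
have c : (2 * pi * (y + a)) @[y --> x] --> 2 * pi * (x + a).
  by apply: cvgM; [exact: cvg_cst | apply: cvgD; [exact: cvg_id | exact: cvg_cst]].
by rewrite expr2; under eq_cvg do rewrite expr2; apply: cvgM.
Qed.

Lemma poisson_ge0 (e a : R) : 0 < e -> 0 <= poisson e a.
Proof.
by move=> e0; rewrite divr_ge0 ?addr_ge0 ?sqr_ge0// mulr_ge0 ?(ltW e0).
Qed.

Lemma poissonN (e a : R) : poisson e (- a) = poisson e a.
Proof. by rewrite /poisson mulrN sqrrN. Qed.

Lemma cvgy_atan_affine (k c : R) : 0 < k ->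
  atan (k * x + c) / pi @[x --> +oo] --> (2^-1 : R).
Proof.
move=> k0; have -> : 2^-1 = pi / 2 / pi :> R.
  have h2 : (pi : R) != 0 by rewrite gt_eqF// pi_gt0.
  by move: (@pi R) h2 => p h2; field.
by apply: cvgM (cvg_cst _); apply: (cvgy_scale_comp (h := atan)) => //; exact: cvgy_atan.
Qed.

(** Each half line contributes 1/2, and the arctangents left over at 0 are opposite. *)
Lemma integral_poisson (e a : R) : 0 < e ->
  intR leb (fun y => poisson e (a - y)) /\ \int[leb]_y (poisson e (a - y)) = 1.
Proof.
move=> e0; have k0 : 0 < 2 * pi / e by rewrite divr_gt0// mulr_gt0// pi_gt0.
have pE y : poisson e (a - y) = poisson e (y + - a) by rewrite -poissonN opprB.
rewrite (_ : (fun y => poisson e (a - y)) = fun y => poisson e (y + - a)); last exact/funext.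
have := FTC_line (@continuous_poisson e (- a) e0) (fun x => poisson_ge0 (x + - a) e0)
  (@continuous_poisson e (- a) e0) (@continuous_poisson e a e0)
  (fun x => poisson_derive (- a) x e0) (fun x => poisson_derive a x e0) _ _
  (@cvgy_atan_affine _ _ k0) (@cvgy_atan_affine _ _ k0).
move=> []; first by [].
- by move=> x x0; rewrite -poissonN opprD !opprK.
move=> h ->; split=> //; rewrite !mulr0 !add0r mulrN atanN mulNr opprK.
lra.
Qed.

Lemma cvgy_powRN (d : R) : 0 < d -> (1 + x ^+ 2) `^ (- d) @[x --> +oo] --> (0 : R).
Proof.
move=> d0; apply/cvgr0Pnorm_le => eps eps0; near=> x.
rewrite ger0_norm ?powR_ge0// powRN -[leRHS]invrK lef_pV2 ?posrE ?invr_gt0//; last first.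
  by apply: powR_gt0; rewrite ltr_pwDl// sqr_ge0.
have x1 : 1 <= x by near: x; apply: nbhs_pinfty_ge; rewrite num_real.
(* Beyond 1 and this threshold, (1 + x^2)^d >= x^d >= 1 / eps. *)
have xA : (eps^-1) `^ (d^-1) <= x by near: x; apply: nbhs_pinfty_ge; rewrite num_real.
have -> : eps^-1 = ((eps^-1) `^ (d^-1)) `^ d.
  by rewrite -powRrM mulVf ?gt_eqF// powRr1// invr_ge0 ltW.
apply: ge0_ler_powR; rewrite ?nnegrE ?powR_ge0 ?(ltW d0)//.
  by rewrite addr_ge0// sqr_ge0.
rewrite (le_trans xA)// (le_trans _ (_ : x ^+ 2 <= _)) ?lerDr//.
by rewrite expr2 ler_peMr// (le_trans ler01).
Unshelve. all: by end_near. Qed.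

(** The antiderivative, on the right half line, of the majorant in [powR_sqr_le] with d = s -
    1/2. *)
Lemma powR_sqr_derive (d x : R) : 0 < d ->
  is_derive x 1 (fun y => 2 * atan y - (1 + y ^+ 2) `^ (- d) / d)
   (2 / (1 + x ^+ 2) + 2 * x * (1 + x ^+ 2) `^ (- d - 1)).
Proof.
move=> d0; have x0 : 0 < 1 + x ^+ 2 by rewrite ltr_pwDl// sqr_ge0.
have h1 : d != 0 by rewrite gt_eqF.
have dp : is_derive x 1 ((fun z : R => z `^ (- d)) \o (fun y => 1 + y ^+ 2))
   (- d * (1 + x ^+ 2) `^ (- d - 1) * (2 * x)).
  apply: is_derive1_comp; first exact: is_derive1_powR.
  by apply: is_derive_eq; rewrite /GRing.scale/=; ring.
have dp' : is_derive x 1 (fun y => (1 + y ^+ 2) `^ (- d))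
   (- d * (1 + x ^+ 2) `^ (- d - 1) * (2 * x)) by exact: dp.
apply: is_derive_eq; rewrite /GRing.scale /=.
have h2 : 1 + x ^+ 2 != 0 by rewrite gt_eqF.
by field; rewrite h1 h2.
Qed.

Lemma continuous_powR_sqr (p : R) : continuous (fun y : R => (1 + y ^+ 2) `^ p).
Proof.
move=> x; have x0 : 0 < 1 + x ^+ 2 by rewrite ltr_pwDl// sqr_ge0.
have dp : is_derive x 1 ((fun z : R => z `^ p) \o (fun y => 1 + y ^+ 2))
   (p * (1 + x ^+ 2) `^ (p - 1) * (2 * x)).
  apply: is_derive1_comp; first exact: is_derive1_powR.
  by apply: is_derive_eq; rewrite /GRing.scale/=; ring.
by apply/differentiable_continuous/derivable1_diffP; case: dp.
Qed.

(** The left side need not have an elementary primitive, but the right side has one on each half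
    line. For |t| <= 1 the first term is at least 1. For |t| > 1, split off (1 + t^2)^(1/2) <= 2 |t|
    and the second term remains. *)
Lemma powR_sqr_le (s t : R) : 2^-1 < s ->
  (1 + t ^+ 2) `^ (- s) <=
  2 / (1 + t ^+ 2) + 2 * `|t| * (1 + t ^+ 2) `^ (- (s - 2^-1) - 1).
Proof.
move=> s1; have t0 : 0 < 1 + t ^+ 2 by rewrite ltr_pwDl// sqr_ge0.
have [t1|t1] := leP (t ^+ 2) 1.
  rewrite (@le_trans _ _ 1)//.
    rewrite powRN invf_le1 ?powR_gt0//.
    rewrite -[leLHS](powRr0 (1 + t ^+ 2)) ler_powR ?lerDl ?sqr_ge0//; lra.
  rewrite -[leLHS]addr0 lerD// ?mulr_ge0 ?powR_ge0//.
  by rewrite ler_pdivlMr// mul1r; lra.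
rewrite -[leLHS]add0r lerD ?divr_ge0 ?(ltW t0)//.
rewrite (_ : - s = 2^-1 + (- (s - 2^-1) - 1)); last by lra.
rewrite powRD; last by apply/implyP => _; rewrite gt_eqF.
rewrite ler_wpM2r ?powR_ge0// powR12_sqrt ?(ltW t0)//.
rewrite -(ler_pXn2r (n := 2))// ?nnegrE ?mulr_ge0// ?sqrtr_ge0//.
by rewrite sqr_sqrtr ?(ltW t0)// exprMn real_normK ?num_real//; lra.
Qed.

Lemma integrable_powR_sqr (s : R) : 2^-1 < s -> intR leb (fun t => (1 + t ^+ 2) `^ (- s)).
Proof.
move=> s1; pose d := s - 2^-1; have d0 : 0 < d by rewrite subr_gt0.
have pos (t : R) : 0 < 1 + t ^+ 2 by rewrite ltr_pwDl// sqr_ge0.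
have csq : continuous (fun y : R => 1 + y ^+ 2).
  move=> x; apply: cvgD; first exact: cvg_cst.
  by rewrite expr2; under eq_cvg do rewrite expr2; apply: cvgM; exact: cvg_id.
have cinv : continuous (fun y : R => 2 / (1 + y ^+ 2)).
  move=> x; apply: cvgM; first exact: cvg_cst.
  by apply: cvgV; [rewrite gt_eqF | exact: csq].
(* The even majorant f equals f1 on the right and, reflected, on the left, so [FTC_line] takes f1
   twice. *)
pose f (t : R) := 2 / (1 + t ^+ 2) + 2 * `|t| * (1 + t ^+ 2) `^ (- d - 1).
pose f1 (t : R) := 2 / (1 + t ^+ 2) + 2 * t * (1 + t ^+ 2) `^ (- d - 1).
have cf : continuous f.
  move=> x; apply: cvgD; first exact: cinv.
  apply: cvgM; last exact: continuous_powR_sqr.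
  by apply: cvgM; [exact: cvg_cst | exact: norm_continuous].
have cf1 : continuous f1.
  move=> x; apply: cvgD; first exact: cinv.
  apply: cvgM; last exact: continuous_powR_sqr.
  by apply: cvgM; [exact: cvg_cst | exact: cvg_id].
have f0 t : 0 <= f t.
  by rewrite addr_ge0 ?divr_ge0 ?(ltW (pos t))// !mulr_ge0 ?powR_ge0.
have lim : 2 * atan y - (1 + y ^+ 2) `^ (- d) / d @[y --> +oo] -->
    (2 * (pi / 2) - 0 / d : R).
  apply: cvgB; first by apply: cvgM; [exact: cvg_cst | exact: cvgy_atan].
  by apply: cvgM; [exact: cvgy_powRN | exact: cvg_cst].
have [] := FTC_line cf f0 cf1 cf1 (fun x => powR_sqr_derive x d0)
  (fun x => powR_sqr_derive x d0) _ _ lim lim.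
- by move=> x x0; rewrite /f ger0_norm.
- by move=> x x0; rewrite /f normrN sqrrN ger0_norm.
move=> fi _; apply: (@integrableR_le _ _ _ leb f) => //.
  by apply: continuous_measurable_fun; exact: continuous_powR_sqr.
by move=> x; rewrite ger0_norm ?powR_ge0//; exact: powR_sqr_le.
Qed.

End line.

(** * Integrals of finite sums and of products with additive phases *)

Section sums.
Context d (T : measurableType d) (R : realType).
Variable mu : {measure set T -> \bar R}.

Lemma Rintegral_sum n (f : nat -> T -> R) : (forall i, intR mu (f i)) ->
  intR mu (fun x => \sum_(i < n) f i x) /\
  \int[mu]_x (\sum_(i < n) f i x) = \sum_(i < n) \int[mu]_x (f i x).
Proof.
move=> fi; elim: n => [|n [ih1 ih2]].
  rewrite big_ord0; split; last first.
    by rewrite /Rintegral; under eq_integral do rewrite big_ord0; rewrite integral0.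
  rewrite (_ : _ \o _ = cst 0%E); first exact: integrable0.
  by apply/funext => x /=; rewrite big_ord0.
have e : (fun x => \sum_(i < n.+1) f i x) = fun x => \sum_(i < n) f i x + f n x.
  by apply/funext => x; rewrite big_ord_recr.
split; first by rewrite e; exact: integrableRD.
by rewrite e RintegralD// ih2 big_ord_recr.
Qed.

End sums.

Section phase.
Context d1 d2 (T1 : measurableType d1) (T2 : measurableType d2) (R : realType).
Variable m1 : {sigma_finite_measure set T1 -> \bar R}.
Variable m2 : {sigma_finite_measure set T2 -> \bar R}.

Lemma integrableR_cos d (T : measurableType d) (mu : {measure set T -> \bar R})
  (A p : T -> R) : intR mu A -> measurable_fun setT p ->
  intR mu (fun x => A x * cos (p x)).
Proof.
move=> iA mp; apply: (integrableRM (M := 1)) => //.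
  by apply: measurableT_comp => //; apply: continuous_measurable_fun; exact: continuous_cos.
by move=> x; rewrite ler_norml cos_geN1 cos_le1.
Qed.

Lemma integrableR_sin d (T : measurableType d) (mu : {measure set T -> \bar R})
  (A p : T -> R) : intR mu A -> measurable_fun setT p ->
  intR mu (fun x => A x * sin (p x)).
Proof.
move=> iA mp; apply: (integrableRM (M := 1)) => //.
  by apply: measurableT_comp => //; apply: continuous_measurable_fun; exact: continuous_sin.
by move=> x; rewrite ler_norml sin_geN1 sin_le1.
Qed.

(** The addition formulas leave mixed products, and each product containing a sine integral
    vanishes. The second conclusion has the shape of the sine hypotheses, so the lemma can be
    iterated one coordinate at a time. *)
Lemma Rintegral_prod_phase (A p : T1 -> R) (B q : T2 -> R) :
  intR m1 A -> intR m2 B -> measurable_fun setT p -> measurable_fun setT q ->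
  \int[m1]_x (A x * sin (p x)) = 0 -> \int[m2]_y (B y * sin (q y)) = 0 ->
  \int[sigma_finite_prod m1 m2]_z (A z.1 * B z.2 * cos (p z.1 + q z.2)) =
    \int[m1]_x (A x * cos (p x)) * \int[m2]_y (B y * cos (q y)) /\
  \int[sigma_finite_prod m1 m2]_z (A z.1 * B z.2 * sin (p z.1 + q z.2)) = 0.
Proof.
move=> iA iB mp mq A0 B0.
have iAc := integrableR_cos iA mp; have iAs := integrableR_sin iA mp.
have iBc := integrableR_cos iB mq; have iBs := integrableR_sin iB mq.
have icc := integrableR_prod iAc iBc; have iss := integrableR_prod iAs iBs.
have ics := integrableR_prod iAc iBs; have isc := integrableR_prod iAs iBc.
have /= ecc := Rintegral_prod iAc iBc; have /= ess := Rintegral_prod iAs iBs.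
have /= ecs := Rintegral_prod iAc iBs; have /= esc := Rintegral_prod iAs iBc.
split.
  rewrite -[RHS]subr0 -[X in _ - X](mulr0 (\int[m1]_x (A x * sin (p x)))) -[X in _ - _ * X]B0.
  rewrite -ecc -ess -RintegralB//; apply: eq_Rintegral => z _.
  by rewrite cosD; ring.
rewrite -[RHS]addr0 -[X in X + _](mul0r (\int[m2]_y (B y * cos (q y)))) -[X in X * _ + _]A0.
rewrite -[X in _ + X](mulr0 (\int[m1]_x (A x * cos (p x)))) -[X in _ + _ * X]B0.
rewrite -ecs -esc -RintegralD//; apply: eq_Rintegral => z _.
by rewrite sinD; ring.
Qed.

End phase.

(** * Product kernels on R^5 and the Poisson approximate identity *)

Section R5.
Variable R : realType.
Local Notation leb := (@lebesgue_measure R).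
Local Notation leb5 := (leb5 R).
Local Notation meas := (measurable_fun setT).

(** The first four factors of [leb5], rebuilt so that every stage carries the sigma-finite structure
    that Fubini asks for. *)
Definition leb4 : {sigma_finite_measure set
    (measurableTypeR R * measurableTypeR R * measurableTypeR R * measurableTypeR R)%type
    -> \bar R} :=
  sigma_finite_prod (sigma_finite_prod (sigma_finite_prod leb leb) leb) leb.

Definition sigma_finite_leb5 : {sigma_finite_measure set (mR5 R) -> \bar R} :=
  sigma_finite_prod leb4 leb.

(* Proved through the underlying set functions: converting the two measure
structures directly is very slow. *)
Lemma leb5E : leb5 = sigma_finite_leb5 :> {measure set (mR5 R) -> \bar R}.
Proof.
have e : (leb5 : set _ -> _) = sigma_finite_leb5 by reflexivity.
apply: eq_measure; exact: e.
Qed.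

(** Indexed by [nat], with 4 and beyond giving z, so that product kernels are described by plain
    sequences of one-variable functions. *)
Definition coord5 (i : nat) (x : R5 R) : R :=
  match i with 0 => x.1.1.1.1 | 1 => x.1.1.1.2 | 2 => x.1.1.2 | 3 => x.1.2 | _ => x.2 end%N.

Definition prod5 (k : nat -> R -> R) (x : R5 R) : R := \prod_(i < 5) k i (coord5 i x).

Lemma prod5E k (x : R5 R) : prod5 k x =
  k 0 x.1.1.1.1 * k 1 x.1.1.1.2 * k 2 x.1.1.2 * k 3 x.1.2 * k 4 x.2.
Proof. by rewrite /prod5 !big_ord_recr big_ord0 /= mul1r. Qed.

Lemma dot5E (x y : R5 R) : dot5 x y = \sum_(i < 5) coord5 i x * coord5 i y.
Proof.
by case: x => [[[[? ?] ?] ?] ?]; case: y => [[[[? ?] ?] ?] ?]; rewrite !big_ord_recr big_ord0 /= add0r.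
Qed.

Lemma measurable_coord5 i : measurable_fun [set: mR5 R] (coord5 i).
Proof.
have h : measurable_fun [set: mR5 R] (fun x => x.1.1).
  exact: (measurableT_comp measurable_fst measurable_fst).
have h2 : measurable_fun [set: mR5 R] (fun x => x.1.1.1).
  by apply: (measurableT_comp measurable_fst h).
case: i => [|[|[|[|i]]]].
- exact: (measurableT_comp measurable_fst h2).
- exact: (measurableT_comp measurable_snd h2).
- exact: (measurableT_comp measurable_snd h).
- exact: (measurableT_comp measurable_snd measurable_fst).
- exact: measurable_snd.
Qed.

Lemma measurable_dot5 d (T : measurableType d) (u v : T -> mR5 R) :
  meas u -> meas v -> meas (fun t => dot5 (u t) (v t)).
Proof.
move=> mu mv; under eq_fun do rewrite dot5E; apply: measurable_sum => i.
apply: measurable_funM.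
  exact: (measurableT_comp (measurable_coord5 i) mu).
exact: (measurableT_comp (measurable_coord5 i) mv).
Qed.

Lemma Rintegral_prod5 k : (forall i, intR leb (k i)) ->
  intR leb5 (prod5 k) /\ \int[leb5]_x (prod5 k x) = \prod_(i < 5) \int[leb]_t (k i t).
Proof.
move=> ik; rewrite leb5E.
rewrite (_ : prod5 k = fun x => k 0 x.1.1.1.1 * k 1 x.1.1.1.2 * k 2 x.1.1.2 * k 3 x.1.2 * k 4 x.2);
  last by apply/funext => x; exact: prod5E.
have i2 := integrableR_prod (ik 0) (ik 1).
have i3 := integrableR_prod i2 (ik 2).
have i4 := integrableR_prod i3 (ik 3).
split; first exact: (integrableR_prod i4 (ik 4)).
rewrite (Rintegral_prod i4 (ik 4)) (Rintegral_prod i3 (ik 3)).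
rewrite (Rintegral_prod i2 (ik 2)) (Rintegral_prod (ik 0) (ik 1)).
by rewrite !big_ord_recr big_ord0 /= mul1r.
Qed.

Lemma Rintegral_prod5_cos k p : (forall i, intR leb (k i)) -> (forall i, meas (p i)) ->
  (forall i, \int[leb]_t (k i t * sin (p i t)) = 0) ->
  \int[leb5]_x (prod5 k x * cos (\sum_(i < 5) p i (coord5 i x))) =
  \prod_(i < 5) \int[leb]_t (k i t * cos (p i t)).
Proof.
move=> ik mp ks; rewrite leb5E.
have i2 := integrableR_prod (ik 0) (ik 1).
have i3 := integrableR_prod i2 (ik 2).
have i4 := integrableR_prod i3 (ik 3).
have mf d1 d2 (T1 : measurableType d1) (T2 : measurableType d2) (f : T1 -> R) (g : T2 -> R) :
    meas f -> meas g -> measurable_fun [set: T1 * T2] (fun z => f z.1 + g z.2).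
  by move=> mf mg; apply: measurable_funD; [exact: measurable_fst_comp | exact: measurable_snd_comp].
have m2 := mf _ _ _ _ _ _ (mp 0) (mp 1).
have m3 := mf _ _ _ _ _ _ m2 (mp 2).
have m4 := mf _ _ _ _ _ _ m3 (mp 3).
have [c2 s2] := Rintegral_prod_phase (ik 0) (ik 1) (mp 0) (mp 1) (ks 0) (ks 1).
have [c3 s3] := Rintegral_prod_phase i2 (ik 2) m2 (mp 2) s2 (ks 2).
have [c4 s4] := Rintegral_prod_phase i3 (ik 3) m3 (mp 3) s3 (ks 3).
have [c5 _] := Rintegral_prod_phase i4 (ik 4) m4 (mp 4) s4 (ks 4).
rewrite !big_ord_recr big_ord0 /= mul1r -c2 -c3 -c4 -c5.
apply: eq_Rintegral => x _.
by rewrite prod5E !big_ord_recr big_ord0 /= add0r.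
Qed.

Definition exp_weight5 (e : R) := prod5 (fun=> exp_weight e).
(** The width depends on the coordinate because [poisson5_approx] compares with kernels having one
    width equal to 1. *)
Definition poisson5 (e : nat -> R) := prod5 (fun i => poisson (e i)).

Lemma integrable_exp_weight5 e : 0 < e -> intR leb5 (exp_weight5 e).
Proof. by move=> e0; apply: (Rintegral_prod5 _).1 => _; exact: integrable_exp_weight. Qed.

Lemma Rintegral_exp_weight5_cos e a : 0 < e ->
  \int[leb5]_x (exp_weight5 e x * cos (2 * pi * dot5 a x)) = poisson5 (fun=> e) a.
Proof.
move=> e0.
transitivity (\int[leb5]_x (exp_weight5 e x *
    cos (\sum_(i < 5) (fun j t => 2 * pi * (coord5 j a * t)) i (coord5 i x)))).
  by apply: eq_Rintegral => x _; rewrite dot5E mulr_sumr.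
rewrite (@Rintegral_prod5_cos _ (fun j t => 2 * pi * (coord5 j a * t))).
- by apply: eq_bigr => i _; rewrite Rintegral_exp_weight_cos.
- by move=> _; exact: integrable_exp_weight.
- by move=> i; apply: measurable_funM => //; apply: measurable_funM.
- by move=> i; rewrite Rintegral_exp_weight_sin.
Qed.

Lemma Rintegral_poisson5 e a : (forall i, 0 < e i) ->
  intR leb5 (fun y => poisson5 e (a - y)) /\ \int[leb5]_y (poisson5 e (a - y)) = 1.
Proof.
move=> e0.
have E (y : R5 R) : poisson5 e (a - y) =
    prod5 (fun i t => poisson (e i) (coord5 i a - t)) y by rewrite /poisson5 !prod5E.
have [i1 i2] := Rintegral_prod5 (fun i => (integral_poisson (coord5 i a) (e0 i)).1).
rewrite (_ : (fun y => poisson5 e (a - y)) = prod5 (fun i t => poisson (e i) (coord5 i a - t))).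
  split=> //; rewrite i2 big1// => i _.
  exact: (integral_poisson (coord5 i a) (e0 i)).2.
exact/funext.
Qed.

Lemma poisson5_ge0 e a : (forall i, 0 < e i) -> 0 <= poisson5 e a.
Proof. by move=> e0; apply: prodr_ge0 => i _; exact: poisson_ge0. Qed.

(* The factor t^2/(1+t^2) trades the Poisson kernel of width e for e times the one of width 1. *)
Lemma poisson_tail (e t : R) : 0 < e -> t ^+ 2 / (1 + t ^+ 2) * poisson e t <= e * poisson 1 t.
Proof.
move=> e0; rewrite /poisson expr1n mulr1.
have u1 : 1 <= (2 * pi : R) ^+ 2.
  by rewrite expr_ge1//; have := @pi_ge2 R; lra.
rewrite exprMn; move: ((2 * pi) ^+ 2) u1 => u u1.
have T0 := sqr_ge0 t; move: (t ^+ 2) T0 => T T0.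
have e2 : 0 < e ^+ 2 by rewrite exprn_gt0.
have uT : 0 <= u * T by rewrite mulr_ge0// (le_trans ler01).
have D1 : 0 < (1 + T) * (e ^+ 2 + u * T) by rewrite mulr_gt0//; lra.
have D2 : 0 < 1 + u * T by lra.
rewrite (_ : T / (1 + T) * (2 * e / (e ^+ 2 + u * T)) = 2 * e * T / ((1 + T) * (e ^+ 2 + u * T)));
  last by field; rewrite !gt_eqF//; lra.
rewrite (_ : e * (2 / (1 + u * T)) = 2 * e / (1 + u * T)); last by ring.
rewrite ler_pdivrMr// [leRHS]mulrAC ler_pdivlMr// -!(mulrA (2 * e)).
by rewrite ler_wpM2l ?mulr_ge0 ?(ltW e0)//; nra.
Qed.

Lemma ball_R5 (x y : R5 R) (r : R) :
  (forall i : 'I_5, `|coord5 i x - coord5 i y| < r) -> ball x r y.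
Proof.
move: x y => [[[[x0 x1] x2] x3] x4] [[[[y0 y1] y2] y3] y4] h.
by split; [split; [split; [split|]|]|];
  [exact: (h (@Ordinal 5 0 isT))|exact: (h (@Ordinal 5 1 isT))|exact: (h (@Ordinal 5 2 isT))
  |exact: (h (@Ordinal 5 3 isT))|exact: (h (@Ordinal 5 4 isT))].
Qed.

(** Near x, |g y - g x| is small by continuity. Elsewhere some coordinate differs by at least r, and
    the bound 2 M is absorbed by a multiple of the sum of phi(x_i - y_i). Against the kernel each of
    these five terms integrates to at most e_n, by [poisson_tail] and unit mass. *)
Lemma poisson5_approx (g : R5 R -> R) (M : R) (x : R5 R) (e_ : nat -> R) :
  measurable_fun [set: mR5 R] g -> (forall y, `|g y| <= M) -> {for x, continuous g} ->
  (forall n, 0 < e_ n) -> e_ n @[n --> \oo] --> 0 ->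
  (\int[leb5]_y (g y * poisson5 (fun=> e_ n) (x - y))) @[n --> \oo] --> g x.
Proof.
move=> mg gM cg e0 ecvg.
have M0 : 0 <= M := le_trans (normr_ge0 _) (gM x).
apply/cvgrPdist_le => del del0.
have d20 : 0 < del / 2 by rewrite divr_gt0.
have /nbhs_ballP[r /= r0 hr] : \forall y \near x, `|g x - g y| <= del / 2.
  by move/cvgrPdist_le : cg; apply.
(* Chosen so that C r^2 / (1 + r^2) = 2 M, while phi is at least r^2 / (1 + r^2) at distance r or
   more. *)
pose C := 2 * M * (1 + r ^+ 2) / r ^+ 2.
have r2 : 0 < r ^+ 2 by rewrite exprn_gt0.
have C0 : 0 <= C by rewrite divr_ge0 ?(ltW r2)// !mulr_ge0// addr_ge0// ltW.
pose phi (t : R) := t ^+ 2 / (1 + t ^+ 2).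
have phi0 t : 0 <= phi t by rewrite divr_ge0 ?addr_ge0 ?sqr_ge0.
have gle y : `|g y - g x| <= del / 2 + C * \sum_(i < 5) phi (coord5 i x - coord5 i y).
  have [/existsP[i hi]|/existsPn h] := boolP [exists i : 'I_5, r <= `|coord5 i x - coord5 i y|].
    rewrite -[leLHS]add0r lerD ?(ltW d20)//.
    apply: (@le_trans _ _ (2 * M)).
      by rewrite (le_trans (ler_normB _ _))// mulr_natl mulr2n lerD.
    rewrite (bigD1 i)//= mulrDr -[leLHS]addr0 lerD//; last first.
      by rewrite mulr_ge0// sumr_ge0.
    have -> : 2 * M = C * (r ^+ 2 / (1 + r ^+ 2)).
      by rewrite /C; field; rewrite !gt_eqF//; lra.
    rewrite ler_wpM2l// /phi; set t := coord5 i x - coord5 i y.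
    have tr : r ^+ 2 <= t ^+ 2.
      by rewrite -(real_normK (num_real t)) lerXn2r// ?nnegrE ?(ltW r0).
    have t2 := sqr_ge0 t.
    rewrite ler_pdivrMr; last by lra.
    rewrite [leRHS]mulrAC ler_pdivlMr; last by lra.
    by rewrite !mulrDr !mulr1 (mulrC (r ^+ 2)) lerD2r.
  rewrite -[leLHS]addr0 lerD//; last by rewrite mulr_ge0// sumr_ge0.
  rewrite distrC; apply: hr; apply: ball_R5 => i.
  by rewrite ltNge; exact: h.
have e1 n (i : nat) : 0 < e_ n by [].
pose P n := poisson5 (fun=> e_ n).
(* The kernel with its i-th width reset to 1: [poisson_tail] is applied in coordinate i, the other
   factors being untouched. *)
pose Pi (n i : nat) := poisson5 (fun j => if j == i then 1 else e_ n).
have ei (n i j : nat) : 0 < (if j == i then 1 else e_ n) by case: ifP.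
have PPi n i y : (i < 5)%N -> phi (coord5 i y) * P n y <= e_ n * Pi n i y.
  move=> i5; rewrite /P /Pi /poisson5 /prod5 (bigD1 (Ordinal i5))//=.
  rewrite [X in _ <= _ * X](bigD1 (Ordinal i5))//= eqxx.
  rewrite (mulrA (phi _)) (mulrA (e_ n)); under [X in _ <= _ * X]eq_bigr => j ji.
    rewrite ifN; last by [].
    over.
  rewrite ler_wpM2r//; last exact: poisson_tail.
  by apply: prodr_ge0 => j _; exact: poisson_ge0.
have dP n : intR leb5 (fun y => P n (x - y)) by exact: (Rintegral_poisson5 x (e1 n)).1.
have sP n := Rintegral_sum 5 (fun i => (Rintegral_poisson5 x (ei n i)).1).
have gP n : intR leb5 (fun y => P n (x - y) * g y) by exact: (integrableRM (M := M) (dP n)).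
have bound n : `|g x - \int[leb5]_y (g y * P n (x - y))| <= del / 2 + 5 * C * e_ n.
  rewrite distrC.
  have -> : \int[leb5]_y (g y * P n (x - y)) - g x = \int[leb5]_y ((g y - g x) * P n (x - y)).
    have e : \int[leb5]_y (g x * P n (x - y)) = g x.
      by rewrite RintegralZl// (Rintegral_poisson5 x (e1 n)).2 mulr1.
    rewrite -[X in _ - X]e -RintegralB//; first by apply: eq_Rintegral => y _; rewrite mulrBl.
      by under eq_fun do rewrite mulrC.
    exact: integrableRZ.
  have iB : intR leb5 (fun y => del / 2 * P n (x - y) + C * e_ n * \sum_(i < 5) Pi n i (x - y)).
    by apply: integrableRD; apply: integrableRZ => //; exact: (sP n).1.
  have iL : intR leb5 (fun y => (g y - g x) * P n (x - y)).
    under eq_fun do rewrite mulrBl.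
    rewrite (_ : (fun y => _) = fun y => P n (x - y) * g y + (- g x) * P n (x - y)).
      by apply: integrableRD => //; exact: integrableRZ.
    by apply/funext => y; ring.
  apply: (le_trans (le_normr_Rintegral measurableT iL)).
  apply: (@le_trans _ _ (\int[leb5]_y (del / 2 * P n (x - y) + C * e_ n * \sum_(i < 5) Pi n i (x - y)))).
    apply: le_Rintegral => //; first exact: integrableR_norm.
    move=> y _; rewrite normrM (ger0_norm (poisson5_ge0 _ (e1 n))).
    apply: (@le_trans _ _ ((del / 2 + C * \sum_(i < 5) phi (coord5 i x - coord5 i y)) * P n (x - y))).
      by rewrite ler_wpM2r// poisson5_ge0.
    rewrite mulrDl lerD2l -(mulrA C) -(mulrA C) ler_wpM2l// mulr_suml mulr_sumr; apply: ler_sum => i _.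
    have := PPi n i (x - y) (ltn_ord i); congr (phi _ * _ <= _).
    by move: i => [[|[|[|[|i]]]]].
  rewrite RintegralD//; [|exact: integrableRZ|by apply: integrableRZ; exact: (sP n).1].
  rewrite !RintegralZl//; last exact: (sP n).1.
  rewrite (sP n).2 (Rintegral_poisson5 x (e1 n)).2 mulr1 lerD2l.
  under eq_bigr => i _ do rewrite (Rintegral_poisson5 x (ei n i)).2.
  by rewrite sumr_const card_ord; lra.
near=> n; apply: (le_trans (bound n)).
rewrite [leRHS]splitr lerD2l.
(* This forces 5 C e_n <= del / 2; the summand 1 guards against C = 0. *)
have : `|e_ n| <= (del / 2) / (5 * C + 1).
  near: n; move/cvgr0Pnorm_le : ecvg; apply; rewrite divr_gt0//; lra.
rewrite ger0_norm ?(ltW (e0 n))// ler_pdivlMr; last by lra.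
apply: le_trans; rewrite mulrC ler_wpM2l ?(ltW (e0 n))//; lra.
Unshelve. all: by end_near. Qed.

End R5.

(** * Fourier integrals and the Parseval identity *)

Section fourier.
Variable R : realType.
Local Notation leb5 := (leb5 R).
Local Notation meas := (measurable_fun setT).
Implicit Types f g : R5 R -> R.

(** [fourier_L1 f] is the pair of [fourier_cos f] and minus [fourier_sin f]. *)
Definition fourier_cos f (xi : R5 R) := \int[leb5]_x (f x * cos (2 * pi * dot5 x xi)).
Definition fourier_sin f (xi : R5 R) := \int[leb5]_x (f x * sin (2 * pi * dot5 x xi)).

Lemma measurable_phase d (T : measurableType d) (u v : T -> mR5 R) :
  meas u -> meas v -> meas (fun t => 2 * pi * dot5 (u t) (v t)).
Proof. by move=> mu mv; apply: measurable_funM => //; exact: measurable_dot5. Qed.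

Lemma measurable_cosR : meas (@cos R).
Proof. by apply: continuous_measurable_fun; exact: continuous_cos. Qed.

Lemma measurable_sinR : meas (@sin R).
Proof. by apply: continuous_measurable_fun; exact: continuous_sin. Qed.

Lemma normr_cos_le1 (x : R) : `|cos x| <= 1.
Proof. by rewrite ler_norml cos_geN1 cos_le1. Qed.

Lemma normr_sin_le1 (x : R) : `|sin x| <= 1.
Proof. by rewrite ler_norml sin_geN1 sin_le1. Qed.

Lemma phase_measurable (xi : R5 R) : measurable_fun [set: mR5 R] (fun x => 2 * pi * dot5 x xi).
Proof. by apply: measurable_phase. Qed.

Lemma integrable_fourier_cos f xi : intR leb5 f ->
  intR leb5 (fun x => f x * cos (2 * pi * dot5 x xi)).
Proof. by move=> fi; apply: integrableR_cos => //; exact: phase_measurable. Qed.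

Lemma integrable_fourier_sin f xi : intR leb5 f ->
  intR leb5 (fun x => f x * sin (2 * pi * dot5 x xi)).
Proof. by move=> fi; apply: integrableR_sin => //; exact: phase_measurable. Qed.

Lemma fourier_cos_le f xi : intR leb5 f -> `|fourier_cos f xi| <= \int[leb5]_x `|f x|.
Proof.
move=> fi; have ic := integrable_fourier_cos xi fi.
apply: (le_trans (le_normr_Rintegral measurableT ic)).
apply: le_Rintegral => //; [exact: integrableR_norm|exact: integrableR_norm|].
by move=> x _; rewrite normrM ler_piMr// normr_cos_le1.
Qed.

Lemma fourier_sin_le f xi : intR leb5 f -> `|fourier_sin f xi| <= \int[leb5]_x `|f x|.
Proof.
move=> fi; have ic := integrable_fourier_sin xi fi.
apply: (le_trans (le_normr_Rintegral measurableT ic)).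
apply: le_Rintegral => //; [exact: integrableR_norm|exact: integrableR_norm|].
by move=> x _; rewrite normrM ler_piMr// normr_sin_le1.
Qed.

Lemma measurable_fourier_cos f : measurable_fun [set: mR5 R] f ->
  measurable_fun [set: mR5 R] (fourier_cos f).
Proof.
move=> mf; rewrite /fourier_cos leb5E.
apply: (measurable_Rintegral (sigma_finite_leb5 R)
  (f := fun z : mR5 R * mR5 R => f z.2 * cos (2 * pi * dot5 z.2 z.1))).
apply: measurable_funM; first exact: measurable_snd_comp.
by apply: measurableT_comp; [exact: measurable_cosR | exact: measurable_phase].
Qed.

Lemma measurable_fourier_sin f : measurable_fun [set: mR5 R] f ->
  measurable_fun [set: mR5 R] (fourier_sin f).
Proof.
move=> mf; rewrite /fourier_sin leb5E.
apply: (measurable_Rintegral (sigma_finite_leb5 R)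
  (f := fun z : mR5 R * mR5 R => f z.2 * sin (2 * pi * dot5 z.2 z.1))).
apply: measurable_funM; first exact: measurable_snd_comp.
by apply: measurableT_comp; [exact: measurable_sinR | exact: measurable_phase].
Qed.

Lemma dot5BlE (x y xi : R5 R) : dot5 (x - y) xi = dot5 x xi - dot5 y xi.
Proof.
rewrite !dot5E -sumrB; apply: eq_bigr => i _; rewrite -mulrBl; congr (_ * _).
by move: i => [[|[|[|[|i]]]]].
Qed.

(** The real part of exp(2 pi i x.xi) g^(xi). *)
Lemma fourier_cos_translate g x xi : intR leb5 g ->
  \int[leb5]_y (g y * cos (2 * pi * dot5 (x - y) xi)) =
  cos (2 * pi * dot5 x xi) * fourier_cos g xi + sin (2 * pi * dot5 x xi) * fourier_sin g xi.
Proof.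
move=> gi; have ic := integrable_fourier_cos xi gi; have is_ := integrable_fourier_sin xi gi.
rewrite /fourier_cos /fourier_sin -!RintegralZl//.
rewrite -RintegralD//; [|exact: integrableRZ|exact: integrableRZ].
apply: eq_Rintegral => y _; rewrite dot5BlE mulrBr cosB; ring.
Qed.

(** The left integrand is the weight times the real part of conj(f^) g^. With the weight, the
    integral over xi, x and y converges absolutely. Two exchanges bring xi innermost, where it
    produces the kernel at x - y. *)
Lemma fourier_regularized f g e : 0 < e -> intR leb5 f -> intR leb5 g ->
  \int[leb5]_xi (exp_weight5 e xi *
    (fourier_cos f xi * fourier_cos g xi + fourier_sin f xi * fourier_sin g xi)) =
  \int[leb5]_x (f x * \int[leb5]_y (g y * poisson5 (fun=> e) (x - y))).
Proof.
move=> e0 fi gi.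
have wi := integrable_exp_weight5 e0.
have mg := integrableR_measurable gi.
have mgc := measurable_fourier_cos mg; have mgs := measurable_fourier_sin mg.
pose B := \int[leb5]_x `|g x|.
(* First exchange, between xi and x: the coupling c already contains g^ and is bounded by twice the
   L^1 norm of g. The second, between xi and y at fixed x, has the cosine [c2] as its coupling. *)
pose c (z : mR5 R * mR5 R) := cos (2 * pi * dot5 z.2 z.1) * fourier_cos g z.1 +
  sin (2 * pi * dot5 z.2 z.1) * fourier_sin g z.1.
have mc : meas c.
  apply: measurable_funD; apply: measurable_funM.
  - by apply: measurableT_comp; [exact: measurable_cosR | exact: measurable_phase].
  - exact: measurable_fst_comp.
  - by apply: measurableT_comp; [exact: measurable_sinR | exact: measurable_phase].
  - exact: measurable_fst_comp.
have cB z : `|c z| <= B + B.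
  rewrite (le_trans (ler_normD _ _))// lerD// normrM -[leRHS]mul1r ler_pM//.
  - exact: normr_cos_le1.
  - exact: fourier_cos_le.
  - exact: normr_sin_le1.
  - exact: fourier_sin_le.
transitivity (\int[leb5]_xi (exp_weight5 e xi * \int[leb5]_x (f x * c (xi, x)))).
  apply: eq_Rintegral => xi _; congr (_ * _).
  have ic := integrable_fourier_cos xi fi; have is_ := integrable_fourier_sin xi fi.
  rewrite {1}/fourier_cos [X in _ + X * _]/fourier_sin -!RintegralZr//.
  rewrite -RintegralD//.
  - by apply: eq_Rintegral => x _; rewrite /c /=; ring.
  - by under eq_fun do rewrite mulrC; exact: integrableRZ.
  - by under eq_fun do rewrite mulrC; exact: integrableRZ.
rewrite leb5E in wi fi *.
rewrite (Rintegral_exchange wi fi mc cB) -leb5E.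
apply: eq_Rintegral => x _; congr (_ * _).
under eq_Rintegral => xi _ do rewrite /c /= -fourier_cos_translate//.
pose c2 (z : mR5 R * mR5 R) := cos (2 * pi * dot5 (x - z.2) z.1).
have mc2 : meas c2.
  rewrite /c2; under eq_fun do rewrite dot5BlE.
  apply: measurableT_comp; first exact: measurable_cosR.
  apply: measurable_funM => //; apply: measurable_funB; exact: measurable_dot5.
have c21 z : `|c2 z| <= 1 by exact: normr_cos_le1.
rewrite leb5E in gi *.
rewrite (Rintegral_exchange wi gi mc2 c21) -leb5E.
apply: eq_Rintegral => y _; congr (_ * _).
by rewrite -Rintegral_exp_weight5_cos.
Qed.

Lemma exp_weight5_le1 (e : R) x : 0 < e -> `|exp_weight5 e x| <= 1.
Proof.
move=> e0; rewrite /exp_weight5 /prod5 normr_prod; apply: prodr_ile1 => i _.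
rewrite normr_ge0 /= /exp_weight ger0_norm ?expR_ge0// expR_le1.
by rewrite mulNr oppr_le0 mulr_ge0// ltW.
Qed.

Lemma exp_weight5_cvg (e_ : nat -> R) x : e_ n @[n --> \oo] --> (0 : R) ->
  exp_weight5 (e_ n) x @[n --> \oo] --> (1 : R).
Proof.
move=> e0.
have h i : exp_weight (e_ n) (coord5 i x) @[n --> \oo] --> (1 : R).
  have h1 : - e_ n * `|coord5 i x| @[n --> \oo] --> - 0 * `|coord5 i x|.
    by apply: cvgM; [exact: cvgN | exact: cvg_cst].
  rewrite oppr0 mul0r in h1.
  by have := cvg_comp _ _ h1 (@continuous_expR R 0); rewrite expR0.
have E : (fun n => exp_weight5 (e_ n) x) = fun n => exp_weight (e_ n) (coord5 0 x) *
    exp_weight (e_ n) (coord5 1 x) * exp_weight (e_ n) (coord5 2 x) *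
    exp_weight (e_ n) (coord5 3 x) * exp_weight (e_ n) (coord5 4 x).
  by apply/funext => n; rewrite /exp_weight5 prod5E.
rewrite E; have hh := cvgM (cvgM (cvgM (cvgM (h 0) (h 1)) (h 2)) (h 3)) (h 4).
by rewrite !mulr1 in hh; exact: hh.
Qed.

Lemma measurable_poisson e : 0 < e -> meas (poisson e : R -> R).
Proof.
move=> e0; apply: continuous_measurable_fun => x.
have := @continuous_poisson R e 0 e0 x.
by rewrite /continuous_at; under eq_cvg do rewrite addr0; rewrite addr0.
Qed.

Lemma measurable_poisson5_sub e : 0 < e ->
  measurable_fun [set: mR5 R * mR5 R] (fun z => poisson5 (fun=> e) (z.1 - z.2)).
Proof.
move=> e0; rewrite (_ : (fun z => _) = fun z : mR5 R * mR5 R =>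
    \prod_(i < 5) poisson e (coord5 i z.1 - coord5 i z.2)).
  apply: measurable_prod => i _; apply: measurableT_comp; first exact: measurable_poisson.
  by apply: measurable_funB; [apply: (measurable_fst_comp (measurable_coord5 i))
    | apply: (measurable_snd_comp (measurable_coord5 i))].
apply/funext => z; apply: eq_bigr => i _; congr poisson.
by move: i => [[|[|[|[|i]]]]].
Qed.

(** Let e = 1 / (n + 1) tend to 0 in [fourier_regularized]. On the frequency side the L^1 norm of f
    times |g^_cos| + |g^_sin| dominates. On the space side unit mass of the kernel bounds the inner
    integral by M, so M |f| dominates. *)
Theorem parseval f g M : intR leb5 f -> intR leb5 g -> (forall x, `|g x| <= M) ->
  continuous g -> intR leb5 (fourier_cos g) -> intR leb5 (fourier_sin g) ->
  \int[leb5]_x (f x * g x) =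
  \int[leb5]_xi (fourier_cos f xi * fourier_cos g xi + fourier_sin f xi * fourier_sin g xi).
Proof.
move=> fi gi gM cg igc igs.
have mf := integrableR_measurable fi; have mg := integrableR_measurable gi.
pose e_ (n : nat) : R := n.+1%:R^-1.
have e0 n : 0 < e_ n by rewrite invr_gt0.
have ecvg : e_ n @[n --> \oo] --> (0 : R) by exact: cvg_harmonic.
pose B := \int[leb5]_x `|f x|.
pose H xi := fourier_cos f xi * fourier_cos g xi + fourier_sin f xi * fourier_sin g xi.
have mH : measurable_fun [set: mR5 R] H.
  apply: measurable_funD; apply: measurable_funM.
  - exact: measurable_fourier_cos.
  - exact: measurable_fourier_cos.
  - exact: measurable_fourier_sin.
  - exact: measurable_fourier_sin.
have lim1 : (\int[leb5]_xi (exp_weight5 (e_ n) xi * H xi)) @[n --> \oo] --> \int[leb5]_xi (H xi).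
  apply: (@dominated_cvg_Rintegral _ _ _ leb5 (fun n xi => exp_weight5 (e_ n) xi * H xi) H
    (fun xi => B * (`|fourier_cos g xi| + `|fourier_sin g xi|))).
  - move=> n; apply: (measurable_funM _ mH).
    exact: integrableR_measurable (integrable_exp_weight5 (e0 n)).
  - move=> x; have h := cvgM (exp_weight5_cvg x ecvg) (cvg_cst (H x)).
    by rewrite mul1r in h; exact: h.
  - by apply: integrableRZ; apply: integrableRD; exact: integrableR_norm.
  - move=> n x; rewrite normrM -[leRHS]mul1r ler_pM//; first exact: exp_weight5_le1.
    rewrite mulrDr (le_trans (ler_normD _ _))// !normrM lerD// ler_wpM2r//.
      exact: fourier_cos_le.
    exact: fourier_sin_le.
have lim2 : (\int[leb5]_x (f x * \int[leb5]_y (g y * poisson5 (fun=> e_ n) (x - y)))) @[n --> \oo] -->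
    \int[leb5]_x (f x * g x).
  have M0 : 0 <= M := le_trans (normr_ge0 _) (gM 0).
  have iP n x := Rintegral_poisson5 x (fun _ : nat => e0 n).
  have igP n x : intR leb5 (fun y => g y * poisson5 (fun=> e_ n) (x - y)).
    under eq_fun do rewrite mulrC.
    by apply: (integrableRM (M := M) (iP n x).1).
  apply: (@dominated_cvg_Rintegral _ _ _ leb5
    (fun n x => f x * \int[leb5]_y (g y * poisson5 (fun=> e_ n) (x - y))) _ (fun x => M * `|f x|)).
  - move=> n; apply: measurable_funM => //.
    rewrite leb5E; apply: (measurable_Rintegral (sigma_finite_leb5 R)
      (f := fun z : mR5 R * mR5 R => g z.2 * poisson5 (fun=> e_ n) (z.1 - z.2))).
    apply: measurable_funM; first exact: measurable_snd_comp.
    exact: measurable_poisson5_sub.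
  - move=> x; apply: cvgM; first exact: cvg_cst.
    by apply: (poisson5_approx (M := M)) => //; exact: cg.
  - by apply: integrableRZ; exact: integrableR_norm.
  - move=> n x; rewrite normrM mulrC ler_wpM2r//.
    apply: (le_trans (le_normr_Rintegral measurableT (igP n x))).
    apply: (@le_trans _ _ (\int[leb5]_y (M * poisson5 (fun=> e_ n) (x - y)))).
      apply: le_Rintegral => //; [exact: integrableR_norm|by apply: integrableRZ; exact: (iP n x).1|].
      move=> y _; rewrite normrM (ger0_norm (poisson5_ge0 _ (fun _ : nat => e0 n))).
      by rewrite ler_wpM2r// poisson5_ge0.
    by rewrite RintegralZl ?(iP n x).2 ?mulr1//; exact: (iP n x).1.
have e : (fun n => \int[leb5]_x (f x * \int[leb5]_y (g y * poisson5 (fun=> e_ n) (x - y)))) =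
    fun n => \int[leb5]_xi (exp_weight5 (e_ n) xi * H xi).
  by apply/funext => n; rewrite fourier_regularized.
by rewrite e in lim2; exact: (cvg_unique _ lim2 lim1).
Qed.

End fourier.

(** * Fourier transform of the z-derivative *)

Section derivative.
Variable R : realType.
Local Notation leb := (@lebesgue_measure R).
Local Notation leb5 := (leb5 R).
Local Notation meas := (measurable_fun setT).
Local Notation ez := ((0, 1) : R5 R).

Lemma Rintegral_derivative_eq0 (h h' : R -> R) (N : R) :
  (forall z : R, is_derive z 1 h (h' z)) -> continuous h' ->
  (forall z, N < `|z| -> h z = 0 /\ h' z = 0) -> \int[leb]_z (h' z) = 0.
Proof.
(* K exceeds N, so h vanishes at both ends of [-K, K] and h' outside; K > 0 keeps the interval
   nondegenerate. *)
move=> dh ch hN; pose K := `|N| + 1.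
have NK : N < K by rewrite (le_lt_trans (ler_norm _))// ltrDl.
have K0 : 0 < K by rewrite ltr_wpDl.
have KN : N < `|K| by rewrite gtr0_norm.
have KN' : N < `|- K| by rewrite normrN.
have ch0 : continuous h.
  by move=> x; apply/differentiable_continuous/derivable1_diffP; case: (dh x).
have -> : \int[leb]_z (h' z) = Rintegral leb `[- K, K] h'.
  rewrite [RHS]Rintegral_mkcond; apply: eq_Rintegral => z _; rewrite patchE.
  case: ifPn => // /negP zK; apply: (hN _ _).2; rewrite ltNge; apply/negP => zN.
  apply: zK; rewrite inE /= in_itv /= -ler_norml.
  exact: le_trans zN (ltW NK).
rewrite /Rintegral (@continuous_FTC2 _ h' h).
- by rewrite (hN K KN).1 (hN (- K) KN').1 -EFinB subrr.
- by rewrite (lt_trans _ K0)// oppr_lt0.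
- exact: continuous_subspaceT.
- split; first by move=> x _; case: (dh x).
    exact/cvg_at_right_filter/ch0.
  exact/cvg_at_left_filter/ch0.
- by move=> x _; rewrite derive1E; apply: derive_val.
Qed.

(** Both derivatives are limits of the same difference quotients. *)
Lemma is_derive_slice (phi : R5 R -> R) (y : R4 R) (z : R) : derivable phi (y, z) ez ->
  is_derive z 1 (fun t => phi (y, t)) ('D_ez phi (y, z)).
Proof.
move=> dphi.
have e : (fun h : R => h^-1 *: (((fun t => phi (y, t)) \o shift z) (h *: 1) - phi (y, z))) =
    (fun h : R => h^-1 *: ((phi \o shift (y, z)) (h *: ez) - phi (y, z))).
  apply/funext => h; congr (_ *: (_ - _)).
  rewrite /= /shift /=; congr (phi _); congr pair.
  by rewrite /= scaler0 add0r.
by split; [rewrite /derivable e | rewrite /derive e].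
Qed.

Lemma continuous_slice (phi : R5 R -> R) (y : R4 R) : continuous phi ->
  continuous (fun t => phi (y, t)).
Proof.
move=> cphi t; apply: (@continuous_comp _ _ _ (fun t => (y, t)) phi); last exact: cphi.
by apply: (cvg_pair (F := nbhs t) (G := nbhs y) (H := nbhs t)); [exact: cvg_cst | exact: cvg_id].
Qed.

(** Since z is the last factor of [leb5], one Fubini step isolates the integral of a derivative in
    z. *)
Lemma Rintegral_derive_ez_eq0 (psi psi' : R5 R -> R) (N : R) :
  intR leb5 psi' ->
  (forall y (z : R), is_derive z 1 (fun t => psi (y, t)) (psi' (y, z))) ->
  (forall y, continuous (fun t => psi' (y, t))) ->
  (forall x, N < `|x.2| -> psi x = 0 /\ psi' x = 0) -> \int[leb5]_x (psi' x) = 0.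
Proof.
rewrite leb5E => ipsi dpsi cpsi psi0.
rewrite (Rintegral_fubini ipsi).2 -[RHS](_ : \int[leb4 R]_y 0 = 0); last first.
  by rewrite /Rintegral integral0.
apply: eq_Rintegral => y _.
apply: (@Rintegral_derivative_eq0 _ _ N (dpsi y)); first exact: cpsi.
by move=> z zN; exact: (psi0 (y, z) zN).
Qed.

(** Integration by parts: the z-derivatives of phi times the cosine and of phi times the sine have
    integral zero. *)
Lemma fourier_derive_ez (phi : R5 R -> R) (N : R) (xi : R5 R) :
  intR leb5 phi -> intR leb5 ('D_ez phi) ->
  (forall x, derivable phi x ez) -> continuous phi -> continuous ('D_ez phi) ->
  (forall x, N < `|x.2| -> phi x = 0 /\ 'D_ez phi x = 0) ->
  fourier_cos ('D_ez phi) xi = 2 * pi * xi.2 * fourier_sin phi xi /\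
  fourier_sin ('D_ez phi) xi = - (2 * pi * xi.2 * fourier_cos phi xi).
Proof.
move=> ip iD dphi cphi cD phi0.
pose k := 2 * pi * xi.2.
have dE y t : 2 * pi * dot5 (y, t) xi = k * t + 2 * pi * dot4 y xi.1.
  rewrite /dot5 /= /k; ring.
have ds y z := is_derive_slice (dphi (y, z)).
have cl (y : R4 R) : continuous (fun t : R => k * t + 2 * pi * dot4 y xi.1).
  by move=> t; apply: cvgD; [apply: cvgM; [exact: cvg_cst|exact: cvg_id] | exact: cvg_cst].
have c1 (y : R4 R) := @continuous_slice _ y cD; have c2 (y : R4 R) := @continuous_slice _ y cphi.
have c3 (y : R4 R) : continuous (fun t : R => cos (k * t + 2 * pi * dot4 y xi.1)).
  by move=> t; apply: continuous_comp; [exact: cl | exact: continuous_cos].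
have c4 (y : R4 R) : continuous (fun t : R => sin (k * t + 2 * pi * dot4 y xi.1)).
  by move=> t; apply: continuous_comp; [exact: cl | exact: continuous_sin].
have ic := integrable_fourier_cos xi ip; have is_ := integrable_fourier_sin xi ip.
have iDc := integrable_fourier_cos xi iD; have iDs := integrable_fourier_sin xi iD.
split.
- have : \int[leb5]_x ('D_ez phi x * cos (2 * pi * dot5 x xi) +
      (- k) * (phi x * sin (2 * pi * dot5 x xi))) = 0.
    apply: (@Rintegral_derive_ez_eq0 (fun x => phi x * cos (2 * pi * dot5 x xi)) _ N).
    + by apply: integrableRD => //; exact: integrableRZ.
    + move=> y z; under eq_fun do rewrite dE.
      rewrite dE.
      apply: is_derive_eq; rewrite /GRing.scale /=; ring.
    + move=> y; under eq_fun do rewrite dE.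
      by move=> t; exact: (cvgD (cvgM (c1 y t) (c3 y t)) (cvgM (cvg_cst _) (cvgM (c2 y t) (c4 y t)))).
    + by move=> x xN; have [-> ->] := phi0 x xN; rewrite !mul0r mulr0 addr0.
  rewrite RintegralD//; last exact: integrableRZ.
  by rewrite RintegralZl// mulNr => /subr0_eq.
- have : \int[leb5]_x ('D_ez phi x * sin (2 * pi * dot5 x xi) +
      k * (phi x * cos (2 * pi * dot5 x xi))) = 0.
    apply: (@Rintegral_derive_ez_eq0 (fun x => phi x * sin (2 * pi * dot5 x xi)) _ N).
    + by apply: integrableRD => //; exact: integrableRZ.
    + move=> y z; under eq_fun do rewrite dE.
      rewrite dE.
      apply: is_derive_eq; rewrite /GRing.scale /=; ring.
    + move=> y; under eq_fun do rewrite dE.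
      by move=> t; exact: (cvgD (cvgM (c1 y t) (c4 y t)) (cvgM (cvg_cst _) (cvgM (c2 y t) (c3 y t)))).
    + by move=> x xN; have [-> ->] := phi0 x xN; rewrite !mul0r mulr0 addr0.
  rewrite RintegralD//; last exact: integrableRZ.
  by rewrite RintegralZl// => /eqP; rewrite addr_eq0 => /eqP.
Qed.

End derivative.

(** * Boundedness, integrability and measurability for test functions *)

Section test_functions.
Variable R : realType.
Local Notation leb5 := (leb5 R).
Local Notation meas := (measurable_fun setT).

Lemma coord5_le_norm (i : 'I_5) (x : R5 R) : `|coord5 i x| <= `|x|.
Proof.
move: x => [[[[x0 x1] x2] x3] x4].
move: i => [[|[|[|[|i]]]]] _ /=; rewrite !prod_normE /= !le_max lexx ?orbT//.
Qed.

Lemma derive_out_of_support (phi : R5 R -> R) v x :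
  (~ closure [set y | phi y != 0] x) -> phi x = 0 /\ 'D_v phi x = 0.
Proof.
move=> xK.
have n0 : \forall y \near x, phi y = 0.
  move: xK => /existsNP[B /not_implyP[nB AB]]; apply: filterS nB => y By.
  by apply: contrapT => /eqP py; apply: AB; exists y.
split; first exact: nbhs_singleton n0.
by rewrite (near_eq_derive _ n0) derive_cst.
Qed.

Lemma test_function_bounded (phi : R5 R -> R) v : test_function phi ->
  (exists M, forall x, phi x != 0 \/ 'D_v phi x != 0 -> forall i : 'I_5, `|coord5 i x| <= M) /\
  (exists B, forall x, `|phi x| <= B /\ `|'D_v phi x| <= B).
Proof.
move=> [sphi cK]; rewrite /compactly_supported in cK.
split.
  have [M [_ hM]] := compact_bounded cK.
  (* [compact_bounded] provides a bound by every constant larger than M, and [|M| + 1] is one. *)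
  exists (`|M| + 1) => x px i; rewrite (le_trans (coord5_le_norm i x))//.
  apply: hM; first by rewrite (le_lt_trans (ler_norm _))// ltrDl.
  apply: contrapT => /(derive_out_of_support v) [p0 d0].
  by move: px; rewrite p0 d0 eqxx => -[].
have bnd (psi : R5 R -> R) : continuous psi ->
    (forall x, ~ closure [set y | phi y != 0] x -> psi x = 0) -> exists B, forall x, `|psi x| <= B.
  move=> cpsi psi0.
  have cim := continuous_compact (continuous_subspaceT cpsi) cK.
  have [B [_ hB]] := compact_bounded cim.
  exists (`|B| + 1) => x.
  have [xK|xK] := pselect (closure [set y | phi y != 0] x).
    by apply: hB; [rewrite (le_lt_trans (ler_norm _))// ltrDl | exists x].
  by rewrite psi0// normr0 addr_ge0.
have [B1 h1] := bnd phi (sphi [::]).1 (fun x xK => (derive_out_of_support v xK).1).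
have [B2 h2] := bnd ('D_v phi) (sphi [:: v]).1 (fun x xK => (derive_out_of_support v xK).2).
exists (Num.max B1 B2) => x; rewrite !le_max h1 h2 orbT; split=> //.
Qed.

(** On the cube where all |x_i| <= M, exp(- sum |x_i|) is at least exp(- 5 M); a multiple of this
    integrable weight is therefore a majorant. *)
Lemma integrable_bounded_support (psi : R5 R -> R) (M B : R) :
  measurable_fun [set: mR5 R] psi -> (forall x, `|psi x| <= B) ->
  (forall x, psi x != 0 -> forall i : 'I_5, `|coord5 i x| <= M) -> intR leb5 psi.
Proof.
move=> mpsi psiB psiM.
have B0 : 0 <= B := le_trans (normr_ge0 _) (psiB 0).
apply: (@integrableR_le _ _ _ leb5 (fun x => B * (expR M) ^+ 5 * exp_weight5 1 x)) => //.
  by apply: integrableRZ; exact: integrable_exp_weight5.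
move=> x; have [->|px] := eqVneq (psi x) 0.
  rewrite normr0 !mulr_ge0 ?exprn_ge0 ?expR_ge0//.
  by apply: prodr_ge0 => i _; exact: expR_ge0.
rewrite -mulrA (le_trans (psiB x))// ler_peMr//.
rewrite /exp_weight5 /prod5.
have -> : expR M ^+ 5 = \prod_(i < 5) expR M by rewrite prodr_const card_ord.
rewrite -big_split /=; apply: (@le_trans _ _ (\prod_(i < 5) 1)); first by rewrite big1.
apply: ler_prod => i _; rewrite ler01 /= /exp_weight -expRD.
by rewrite -[leLHS](@expR0 R) ler_expR mulN1r subr_ge0; exact: psiM.
Qed.

Lemma measurable_shift5 (a : R5 R) : measurable_fun [set: mR5 R] (fun x : mR5 R => a + x : mR5 R).
Proof.
have mc i : measurable_fun [set: mR5 R] (fun x : mR5 R => coord5 i a + coord5 i x).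
  by apply: measurable_funD => //; exact: measurable_coord5.
rewrite (_ : (fun x => _) = fun x : mR5 R =>
  ((((coord5 0 a + coord5 0 x, coord5 1 a + coord5 1 x), coord5 2 a + coord5 2 x),
     coord5 3 a + coord5 3 x), coord5 4 a + coord5 4 x)); last by apply/funext.
apply: measurable_fun_pair; last exact: (mc 4).
apply: measurable_fun_pair; last exact: (mc 3).
apply: measurable_fun_pair; last exact: (mc 2).
by apply: measurable_fun_pair; [exact: (mc 0) | exact: (mc 1)].
Qed.

(** A pointwise limit of the difference quotients with steps 1 / (n + 1). *)
Lemma measurable_derive (phi : R5 R -> R) v : measurable_fun [set: mR5 R] phi ->
  (forall x, derivable phi x v) -> measurable_fun [set: mR5 R] ('D_v phi).
Proof.
move=> mphi dphi.
apply: (@measurable_fun_cvg _ (mR5 R) R setT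
  (fun n x => (n.+1%:R^-1 : R)^-1 *: (phi (n.+1%:R^-1 *: v + x) - phi x))).
  move=> n; apply: measurable_funM => //; apply: measurable_funB => //.
  exact: (measurableT_comp mphi (measurable_shift5 (n.+1%:R^-1 *: v))).
move=> x _.
(* The steps are nonzero, so they converge in the punctured neighbourhoods used by the
   derivative. *)
have h0 : (n.+1%:R^-1 : R) @[n --> \oo] --> (0 : R)^'.
  move=> P P0.
  have h : \forall n \near \oo, n.+1%:R^-1 != 0 :> R -> P (n.+1%:R^-1) by exact: (cvg_harmonic P0).
  by apply: filterS h => n; apply; rewrite invr_eq0 pnatr_eq0.
exact: (cvg_comp _ _ h0 (dphi x)).
Qed.

End test_functions.

(** * The L^2 Fourier transform: linearity and uniqueness *)

Lemma ae_imply (d : measure_display) (T : measurableType d) (R : realType)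
  (mu : {measure set T -> \bar R}) (P Q : T -> Prop) : (forall x, P x -> Q x) ->
  {ae mu, forall x, P x} -> {ae mu, forall x, Q x}.
Proof. by move=> PQ; apply: filterS. Qed.

(** Stands in for the L^2 triangle inequality: with (p + q)^2 <= 2 p^2 + 2 q^2 it yields both
    linearity and uniqueness of the L^2 transform. *)
Lemma integral_cvg0 (d : measure_display) (T : measurableType d) (R : realType)
  (mu : {measure set T -> \bar R}) (D E1 E2 : nat -> T -> R) (a b : R) :
  (forall n, measurable_fun setT (D n)) -> (forall n, measurable_fun setT (E1 n)) ->
  (forall n, measurable_fun setT (E2 n)) ->
  (forall n x, 0 <= D n x) -> (forall n x, 0 <= E1 n x) -> (forall n x, 0 <= E2 n x) ->
  0 <= a -> 0 <= b -> (forall n x, D n x <= a * E1 n x + b * E2 n x) ->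
  (fun n => \int[mu]_x (E1 n x)%:E)%E @ \oo --> 0%E ->
  (fun n => \int[mu]_x (E2 n x)%:E)%E @ \oo --> 0%E ->
  (fun n => \int[mu]_x (D n x)%:E)%E @ \oo --> 0%E.
Proof.
move=> mD mE1 mE2 D0 E10 E20 a0 b0 DE c1 c2.
have c : (fun n => a%:E * \int[mu]_x (E1 n x)%:E + b%:E * \int[mu]_x (E2 n x)%:E)%E @ \oo
    --> (a%:E * 0 + b%:E * 0)%E.
  by apply: cvgeD; [rewrite !mule0 | exact: cvgeZl | exact: cvgeZl].
rewrite !mule0 adde0 in c.
apply: (squeeze_cvge _ (cvg_cst 0%E) c); apply: nearW => n; apply/andP; split.
  by apply: integral_ge0 => x _; rewrite lee_fin.
have m1 : measurable_fun setT (fun x => (E1 n x)%:E) by exact/measurable_EFinP.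
have m2 : measurable_fun setT (fun x => (E2 n x)%:E) by exact/measurable_EFinP.
rewrite -!ge0_integralZl_EFin//; do ?by move=> x _; rewrite lee_fin.
rewrite -ge0_integralD//; do ?by [move=> x _; rewrite -EFinM lee_fin mulr_ge0
  | exact: measurable_funeM].
apply: ge0_le_integral => //.
- by move=> x _; rewrite lee_fin.
- exact/measurable_EFinP.
- by apply: emeasurable_funD; exact: measurable_funeM.
- by move=> x _; rewrite -!EFinM -EFinD lee_fin.
Qed.

Section fourier_L2.
Variable R : realType.
Local Notation leb5 := (leb5 R).
Local Notation meas := (measurable_fun setT).
Implicit Types (u v : R5 R -> R) (U V W : R5 R -> R * R).

Lemma coord5_le_norm5 (i : 'I_5) (x : R5 R) : `|coord5 i x| <= norm5 x.
Proof.
rewrite -sqrtr_sqr /norm5 dot5E ler_wsqrtr// (bigD1 i)//= -expr2 lerDl.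
by rewrite sumr_ge0// => j _; rewrite -expr2 sqr_ge0.
Qed.

Lemma norm5_le_coord5 (M : R) (x : R5 R) : (forall i : 'I_5, `|coord5 i x| <= M) ->
  norm5 x <= Num.sqrt (5 * M ^+ 2).
Proof.
move=> xM; rewrite /norm5 dot5E ler_wsqrtr//.
apply: (@le_trans _ _ (\sum_(i < 5) M ^+ 2)).
  apply: ler_sum => i _; rewrite -expr2 -(real_normK (num_real (coord5 i x))).
  by rewrite lerXn2r ?nnegrE// (le_trans (normr_ge0 _) (xM i)).
by rewrite sumr_const card_ord mulr_natl.
Qed.

Lemma measurable_norm5 : measurable_fun [set: mR5 R] (@norm5 R).
Proof.
apply: measurableT_comp.
  by apply: continuous_measurable_fun; exact: sqrt_continuous.
by apply: measurable_dot5.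
Qed.

(** On the ball of radius n one has |u| <= u^2 + 1, and the indicator of the ball is integrable. *)
Lemma integrable_truncate n u : u \in Lfun leb5 2%:E -> intR leb5 (truncate n u).
Proof.
move=> uL; have iu := Lfun2_integrable_sqr uL.
have mu : measurable_fun [set: mR5 R] u by move: uL; rewrite inE => /andP[]; rewrite !inE.
have mt : measurable_fun [set: mR5 R] (truncate n u).
  apply: measurable_fun_ifT => //; apply: measurable_fun_ler => //.
  exact: measurable_norm5.
pose ind (x : R5 R) : R := if norm5 x <= n%:R then 1 else 0.
have mind : measurable_fun [set: mR5 R] ind.
  apply: measurable_fun_ifT => //; apply: measurable_fun_ler => //.
  exact: measurable_norm5.
have iind : intR leb5 ind.
  apply: (@integrable_bounded_support _ _ n%:R 1) => //.
    by move=> x; rewrite /ind; case: ifP => _; rewrite ?normr1 ?normr0.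
  move=> x; rewrite /ind; case: ifP => [xn _ i|]; last by rewrite eqxx.
  exact: le_trans (coord5_le_norm5 i x) xn.
apply: (@integrableR_le _ _ _ leb5 (fun x => u x ^+ 2 + ind x)) => //.
  exact: integrableRD.
move=> x; rewrite /truncate /ind; case: ifP => _; last by rewrite normr0 addr0 sqr_ge0.
rewrite -(real_normK (num_real (u x))); move: `|u x| (normr_ge0 (u x)) => t t0.
by have := sqr_ge0 (t - 1); nra.
Qed.

Lemma truncateE n a u v : truncate n (fun x => a * u x + v x) =
  fun x => a * truncate n u x + truncate n v x.
Proof. by apply/funext => x; rewrite /truncate; case: ifP => // _; rewrite mulr0 addr0. Qed.

Definition fourier_error u U n (xi : R5 R) : R := sqmod (fourier_L1 (truncate n u) xi - U xi).

Lemma fourier_errorE u U n xi : fourier_error u U n xi =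
  (fourier_cos (truncate n u) xi - (U xi).1) ^+ 2 +
  (- fourier_sin (truncate n u) xi - (U xi).2) ^+ 2.
Proof. by []. Qed.

Lemma fourier_error_ge0 u U n xi : 0 <= fourier_error u U n xi.
Proof. by rewrite addr_ge0 ?sqr_ge0. Qed.

Lemma measurable_fst_fun U : measurable_fun [set: mR5 R] U ->
  measurable_fun [set: mR5 R] (fun xi => (U xi).1).
Proof. by move=> mU; exact: (measurableT_comp measurable_fst mU). Qed.

Lemma measurable_snd_fun U : measurable_fun [set: mR5 R] U ->
  measurable_fun [set: mR5 R] (fun xi => (U xi).2).
Proof. by move=> mU; exact: (measurableT_comp measurable_snd mU). Qed.

Lemma measurable_fourier_error u U n : u \in Lfun leb5 2%:E ->
  measurable_fun [set: mR5 R] U -> measurable_fun [set: mR5 R] (fourier_error u U n).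
Proof.
move=> uL mU; have mt := integrableR_measurable (integrable_truncate n uL).
rewrite (_ : fourier_error u U n = fun xi => (fourier_cos (truncate n u) xi - (U xi).1) ^+ 2 +
  (- fourier_sin (truncate n u) xi - (U xi).2) ^+ 2) //.
apply: measurable_funD; apply: measurable_funX; apply: measurable_funB.
- exact: measurable_fourier_cos.
- exact: measurable_fst_fun.
- by apply: measurable_funN; exact: measurable_fourier_sin.
- exact: measurable_snd_fun.
Qed.

Lemma Lfun2_lincomb a u v : u \in Lfun leb5 2%:E -> v \in Lfun leb5 2%:E ->
  (fun x => a * u x + v x) \in Lfun leb5 2%:E.
Proof.
move=> uL vL.
have p1 : (1 <= 2%:E :> \bar R)%E by rewrite lee_fin ler1n.
have h := (@Lfun_submod_closed _ (mR5 R) R leb5 _ p1).2 a _ _ uL vL.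
by move: h.
Qed.

Lemma fourier_L1_truncate_lincomb a u v n xi : u \in Lfun leb5 2%:E -> v \in Lfun leb5 2%:E ->
  fourier_L1 (truncate n (fun x => a * u x + v x)) xi =
  (a * fourier_cos (truncate n u) xi + fourier_cos (truncate n v) xi,
   - (a * fourier_sin (truncate n u) xi + fourier_sin (truncate n v) xi)).
Proof.
move=> uL vL; have iu := integrable_truncate n uL; have iv := integrable_truncate n vL.
have icu := integrable_fourier_cos xi iu; have icv := integrable_fourier_cos xi iv.
have isu := integrable_fourier_sin xi iu; have isv := integrable_fourier_sin xi iv.
congr (_, - _).
  rewrite /fourier_cos -RintegralZl// -RintegralD//; last exact: integrableRZ.
  by apply: eq_Rintegral => x _; rewrite truncateE; ring.
rewrite /fourier_sin -RintegralZl// -RintegralD//; last exact: integrableRZ.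
by apply: eq_Rintegral => x _; rewrite truncateE; ring.
Qed.

Lemma fourier_L2_lincomb a u v U V : u \in Lfun leb5 2%:E -> v \in Lfun leb5 2%:E ->
  is_fourier_L2 u U -> is_fourier_L2 v V ->
  is_fourier_L2 (fun x => a * u x + v x)
    (fun xi => (a * (U xi).1 + (V xi).1, a * (U xi).2 + (V xi).2)).
Proof.
move=> uL vL [mU cU] [mV cV]; have wL := Lfun2_lincomb a uL vL.
have mW : measurable_fun [set: mR5 R] (fun xi => (a * (U xi).1 + (V xi).1, a * (U xi).2 + (V xi).2)).
  apply: measurable_fun_pair; apply: measurable_funD; try (apply: measurable_funM => //);
    do ?[exact: measurable_fst_fun | exact: measurable_snd_fun].
split=> //.
apply: (@integral_cvg0 _ _ _ leb5 (fourier_error _ _) (fourier_error u U) (fourier_error v V)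
  (2 * a ^+ 2) 2) => //; do ?[by move=> n; exact: measurable_fourier_error
  | by move=> n xi; exact: fourier_error_ge0].
- by rewrite mulr_ge0 ?sqr_ge0.
- move=> n xi; rewrite (fourier_errorE u) (fourier_errorE v).
  rewrite /fourier_error fourier_L1_truncate_lincomb// /sqmod /=.
  set p1 := fourier_cos _ _; set p2 := fourier_cos _ _.
  set q1 := fourier_sin _ _; set q2 := fourier_sin _ _.
  have sq2 (p q : R) : (p + q) ^+ 2 <= 2 * p ^+ 2 + 2 * q ^+ 2.
    by have := sqr_ge0 (p - q); nra.
  have e1 := sq2 (a * (p1 - (U xi).1)) (p2 - (V xi).1).
  have e2 := sq2 (a * (- q1 - (U xi).2)) (- q2 - (V xi).2).
  rewrite (_ : a * p1 + p2 - (a * (U xi).1 + (V xi).1) = a * (p1 - (U xi).1) + (p2 - (V xi).1));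
    last by ring.
  rewrite (_ : - (a * q1 + q2) - (a * (U xi).2 + (V xi).2) =
    a * (- q1 - (U xi).2) + (- q2 - (V xi).2)); last by ring.
  by apply: (le_trans (lerD e1 e2)); rewrite le_eqVlt; apply/orP; left; apply/eqP; ring.
Qed.

(** The integral of |U - V|^2 does not depend on n, yet it is at most twice the sum of two errors
    that tend to 0. It is thus 0, and so is its integrand almost everywhere. *)
Lemma fourier_L2_unique u U V : u \in Lfun leb5 2%:E ->
  is_fourier_L2 u U -> is_fourier_L2 u V -> {ae leb5, forall xi, U xi = V xi}.
Proof.
move=> uL [mU cU] [mV cV].
pose D xi := ((U xi).1 - (V xi).1) ^+ 2 + ((U xi).2 - (V xi).2) ^+ 2.
have mD : measurable_fun [set: mR5 R] D.
  by apply: measurable_funD; apply: measurable_funX; apply: measurable_funB;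
    do ?[exact: measurable_fst_fun | exact: measurable_snd_fun].
have D0 xi : 0 <= D xi by rewrite addr_ge0 ?sqr_ge0.
have c : (fun _ : nat => \int[leb5]_xi (D xi)%:E)%E @ \oo --> 0%E.
  apply: (@integral_cvg0 _ _ _ leb5 (fun=> D) (fourier_error u U) (fourier_error u V) 2 2) => //;
    do ?[by move=> n; exact: measurable_fourier_error | by move=> n xi; exact: fourier_error_ge0].
  move=> n xi; rewrite !fourier_errorE /D.
  set p := fourier_cos _ _; set q := - fourier_sin _ _.
  have sq2 (x y z : R) : (x - y) ^+ 2 <= 2 * (z - x) ^+ 2 + 2 * (z - y) ^+ 2.
    by have := sqr_ge0 ((z - x) + (z - y)); nra.
  have := sq2 (U xi).1 (V xi).1 p; have := sq2 (U xi).2 (V xi).2 q; lra.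
have I0 : (\int[leb5]_xi (D xi)%:E = 0)%E.
  by rewrite -(cvg_lim (@ereal_hausdorff R) c); apply/esym/cvg_lim => //; exact: cvg_cst.
have mDE : measurable_fun [set: mR5 R] (fun xi => (D xi)%:E) by exact/measurable_EFinP.
have := (ae_eq_integral_abs leb5 measurableT mDE).1.
case=> [|N [mN N0 sN]].
  by rewrite -[RHS]I0; apply: eq_integral => xi _; rewrite gee0_abs// lee_fin.
exists N; split => // xi /= nxi; apply: sN => /= h; apply: nxi.
have /eqP := h I; rewrite /D /= eqe paddr_eq0 ?sqr_ge0// !sqrf_eq0 !subr_eq0.
by move=> /andP[/eqP h1 /eqP h2]; case: (U xi) (V xi) h1 h2 => [? ?] [? ?] /= -> ->.
Qed.

End fourier_L2.

(** * Sobolev weights and the frequency-side pairing *)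

Section sobolev.
Variable R : realType.
Local Notation leb := (@lebesgue_measure R).
Local Notation leb5 := (leb5 R).
Implicit Types (u v f : R5 R -> R) (U V W : R5 R -> R * R).

(** Once n >= N the truncation is u itself, so the errors are eventually 0. *)
Lemma fourier_L2_of_bounded_support u (N : R) : intR leb5 u ->
  (forall x, u x != 0 -> norm5 x <= N) -> is_fourier_L2 u (fourier_L1 u).
Proof.
move=> iu uN; have mu := integrableR_measurable iu; split.
  apply: measurable_fun_pair; first exact: measurable_fourier_cos.
  by apply: measurable_funN; exact: measurable_fourier_sin.
apply: cvg_near_cst; near=> n.
have nN : N <= n%:R by near: n; exact: nbhs_infty_ger.
have -> : truncate n u = u.
  apply/funext => x; rewrite /truncate; case: ifPn => // xn.
  apply/eqP; rewrite eq_sym; apply: contraT => /uN xN.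
  by rewrite (le_trans xN nN) in xn.
rewrite -[RHS](integral0 leb5 setT); apply: eq_integral => xi _.
by rewrite subrr /sqmod /= expr0n addr0.
Unshelve. all: by end_near. Qed.

(** The symbol of (1 - Laplacian / (4 pi^2))^p in the 2 pi normalization. *)
Definition bessel_weight (p : R) (xi : R5 R) : R := (1 + norm5 xi ^+ 2) `^ p.

Lemma bessel_base_gt0 (xi : R5 R) : 0 < 1 + norm5 xi ^+ 2.
Proof. by rewrite ltr_pwDl// sqr_ge0. Qed.

Lemma measurable_bessel_weight p : measurable_fun [set: mR5 R] (bessel_weight p).
Proof.
apply: (@measurableT_comp _ _ _ _ _ _ (fun z : R => z `^ p)); first exact: measurable_powR.
by apply: measurable_funD => //; apply: measurable_funX; exact: measurable_norm5.
Qed.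

(* The decay is distributed evenly over the five variables, since each
1 + xi_i^2 is at most 1 + |xi|^2. *)
Lemma integrable_bessel_weight p : 5 / 2 < p -> intR leb5 (bessel_weight (- p)).
Proof.
move=> hp; have s1 : 2^-1 < p / 5 by rewrite ltr_pdivlMr//; lra.
apply: (@integrableR_le _ _ _ leb5 (prod5 (fun=> (fun t => (1 + t ^+ 2) `^ (- (p / 5)))))).
- exact: measurable_bessel_weight.
- by apply: (Rintegral_prod5 _).1 => _; exact: integrable_powR_sqr.
move=> xi; rewrite ger0_norm ?powR_ge0//.
have -> : bessel_weight (- p) xi = \prod_(i < 5) (1 + norm5 xi ^+ 2) `^ (- (p / 5)).
  rewrite prodr_const card_ord -powR_mulrn ?powR_ge0// -powRrM /bessel_weight.
  by congr (_ `^ _); field.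
apply: ler_prod => i _; rewrite powR_ge0 /= !powRN.
have p0 (t : R) : 0 < 1 + t ^+ 2 by rewrite ltr_pwDl// sqr_ge0.
rewrite lef_pV2 ?posrE ?powR_gt0 ?bessel_base_gt0//.
apply: ge0_ler_powR; rewrite ?nnegrE ?(ltW (p0 _))//; first lra.
rewrite lerD2l -(real_normK (num_real (coord5 i xi))).
by rewrite lerXn2r ?nnegrE ?sqrtr_ge0//; exact: coord5_le_norm5.
Qed.

Definition weighted_sqr m U xi := bessel_weight m xi * sqmod (U xi).

Lemma weighted_sqr_ge0 m U xi : 0 <= weighted_sqr m U xi.
Proof. by rewrite mulr_ge0 ?powR_ge0// addr_ge0 ?sqr_ge0. Qed.

Lemma measurable_weighted_sqr m U : measurable_fun [set: mR5 R] U ->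
  measurable_fun [set: mR5 R] (weighted_sqr m U).
Proof.
move=> mU; apply: measurable_funM; first exact: measurable_bessel_weight.
by apply: measurable_funD; apply: measurable_funX; [exact: measurable_fst_fun|exact: measurable_snd_fun].
Qed.

Lemma sobolev_weighted_integrable m U : measurable_fun [set: mR5 R] U ->
  (sobolev_weighted m U < +oo)%E -> intR leb5 (weighted_sqr m U).
Proof.
move=> mU /lty_poweRy h; apply/integrableP; split.
  by apply/measurable_EFinP; exact: measurable_weighted_sqr.
rewrite (_ : (\int[leb5]_x _)%E = (\int[leb5]_x (weighted_sqr m U x)%:E)%E).
  by apply: h; rewrite invr_eq0 pnatr_eq0.
by apply: eq_integral => xi _; rewrite /= ger0_norm// weighted_sqr_ge0.
Qed.

Lemma sobolev_weighted_le1 m U : measurable_fun [set: mR5 R] U ->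
  (sobolev_weighted m U <= 1)%E -> \int[leb5]_xi (weighted_sqr m U xi) <= 1.
Proof.
move=> mU h1; have iw := sobolev_weighted_integrable mU (le_lt_trans h1 (ltry 1)).
have := integrable_fin_num measurableT iw.
have r0 : 0 <= \int[leb5]_xi (weighted_sqr m U xi).
  by apply: Rintegral_ge0 => xi _; exact: weighted_sqr_ge0.
move=> /fineK e; move: h1; rewrite /sobolev_weighted.
rewrite -[(\int[leb5]_xi _)%E]/(\int[leb5]_xi (weighted_sqr m U xi)%:E)%E -e poweR_EFin lee_fin.
rewrite powR12_sqrt// -[X in _ <= X]sqrtr1 ler_psqrt ?nnegrE//.
Qed.

Lemma sobolev_weighted_ae m U V : measurable_fun [set: mR5 R] U -> measurable_fun [set: mR5 R] V ->
  {ae leb5, forall xi, U xi = V xi} -> sobolev_weighted m U = sobolev_weighted m V.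
Proof.
move=> mU mV UV; congr (_ `^ _)%E; apply: ge0_ae_eq_integral => //.
- by apply/measurable_EFinP; exact: measurable_weighted_sqr.
- by apply/measurable_EFinP; exact: measurable_weighted_sqr.
- by move=> xi _; rewrite lee_fin weighted_sqr_ge0.
- by move=> xi _; rewrite lee_fin weighted_sqr_ge0.
- by apply: ae_imply UV => xi -> _.
Qed.

Lemma sobolev_weighted_lincomb m (a : R) U V :
  measurable_fun [set: mR5 R] U -> measurable_fun [set: mR5 R] V ->
  (sobolev_weighted m U < +oo)%E -> (sobolev_weighted m V < +oo)%E ->
  (sobolev_weighted m (fun xi => (a * (U xi).1 + (V xi).1, a * (U xi).2 + (V xi).2)%R) < +oo)%E.
Proof.
move=> mU mV wU wV; set W := fun xi => (_, _).
have mW : measurable_fun [set: mR5 R] W.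
  apply: measurable_fun_pair; apply: measurable_funD; try (apply: measurable_funM => //);
    do ?[exact: measurable_fst_fun | exact: measurable_snd_fun].
have iU := integrableRZ (2 * a ^+ 2) (sobolev_weighted_integrable mU wU).
have iV := integrableRZ 2 (sobolev_weighted_integrable mV wV).
have iW : intR leb5 (weighted_sqr m W).
  apply: (@integrableR_le _ _ _ leb5
    (fun xi => 2 * a ^+ 2 * weighted_sqr m U xi + 2 * weighted_sqr m V xi)).
  - exact: measurable_weighted_sqr.
  - exact: integrableRD.
  move=> xi; rewrite ger0_norm ?weighted_sqr_ge0//.
  rewrite /weighted_sqr !(mulrCA _ (bessel_weight m xi)) -mulrDr ler_wpM2l ?powR_ge0// /sqmod /W /=.
  have sq2 (p q : R) : (p + q) ^+ 2 <= 2 * p ^+ 2 + 2 * q ^+ 2.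
    by have := sqr_ge0 (p - q); nra.
  have e1 := sq2 (a * (U xi).1) (V xi).1; have e2 := sq2 (a * (U xi).2) (V xi).2.
  by apply: (le_trans (lerD e1 e2)); rewrite le_eqVlt; apply/orP; left; apply/eqP; ring.
apply: poweR_lty; have := integrable_lty measurableT iW; exact.
Qed.

(** With w = 1 + |xi|^2 and p = w^m, the bound xi_z^2 <= w gives |xi_z| |a| <= w / (2 p) + p a^2 /
    2. The factor xi_z costs one power of w, whence the exponent -(m - 1). *)
Lemma bessel_AMGM m (xi : R5 R) (a b : R) : `|xi.2| * (`|a| + `|b|) <=
  bessel_weight (- (m - 1)) xi + 2^-1 * (bessel_weight m xi * (a ^+ 2 + b ^+ 2)).
Proof.
pose p := bessel_weight m xi; pose w := 1 + norm5 xi ^+ 2.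
have w0 : 0 < w := bessel_base_gt0 xi.
have p0 : 0 < p by rewrite powR_gt0.
have -> : bessel_weight (- (m - 1)) xi = w / p.
  rewrite /bessel_weight -/w opprB powRB; last by apply/implyP => _; rewrite gt_eqF.
  by rewrite powRr1 ?ltW.
have n0 : `|xi.2| ^+ 2 <= w.
  rewrite (@le_trans _ _ (norm5 xi ^+ 2)) ?lerDr// lerXn2r ?nnegrE ?sqrtr_ge0//.
  exact: (coord5_le_norm5 (@Ordinal 5 4 isT)).
have amgm (c : R) : `|xi.2| * `|c| <= 2^-1 * (w / p) + 2^-1 * (p * c ^+ 2).
  rewrite -(real_normK (num_real c)); move: `|c| (normr_ge0 c) `|xi.2| n0 => t t0 n n0.
  have -> : 2^-1 * (w / p) + 2^-1 * (p * t ^+ 2) = (2^-1 * (w + (p * t) ^+ 2)) / p.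
    by field; rewrite gt_eqF.
  rewrite ler_pdivlMr//.
  by have := sqr_ge0 (n - p * t); nra.
rewrite -/p mulrDr; apply: (le_trans (lerD (amgm a) (amgm b))).
by rewrite le_eqVlt; apply/orP; left; apply/eqP; field; rewrite gt_eqF.
Qed.

Lemma bessel_dominated m U xi : `|xi.2| * (`|(U xi).1| + `|(U xi).2|) <=
  bessel_weight (- (m - 1)) xi + 2^-1 * weighted_sqr m U xi.
Proof. exact: bessel_AMGM. Qed.

(** Minus the real part of conj(f^) times 2 pi i xi_z U, which is what moving the derivative onto u
    gives. *)
Definition dz_pairing f U (xi : R5 R) :=
  2 * pi * xi.2 * ((U xi).1 * fourier_sin f xi + (U xi).2 * fourier_cos f xi).

Lemma measurable_dz_pairing f U : intR leb5 f -> measurable_fun [set: mR5 R] U ->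
  measurable_fun [set: mR5 R] (dz_pairing f U).
Proof.
move=> fi mU; have mf := integrableR_measurable fi.
apply: measurable_funM.
  by apply: measurable_funM => //; exact: (measurable_coord5 4).
apply: measurable_funD; apply: measurable_funM.
- exact: measurable_fst_fun.
- exact: measurable_fourier_sin.
- exact: measurable_snd_fun.
- exact: measurable_fourier_cos.
Qed.

Lemma dz_pairing_le m f U xi : intR leb5 f -> `|dz_pairing f U xi| <=
  2 * pi * (\int[leb5]_x `|f x|) * (bessel_weight (- (m - 1)) xi + 2^-1 * weighted_sqr m U xi).
Proof.
move=> fi; set B := \int[leb5]_x `|f x|.
have B0 : 0 <= B by apply: Rintegral_ge0 => x _.
have pi0 : 0 <= 2 * pi :> R by rewrite mulr_ge0// pi_ge0.
rewrite /dz_pairing normrM (normrM (2 * pi)) (ger0_norm pi0).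
rewrite -!(mulrA (2 * pi)) ler_wpM2l//.
apply: (@le_trans _ _ (B * (`|xi.2| * (`|(U xi).1| + `|(U xi).2|)))); last first.
  by rewrite ler_wpM2l//; exact: bessel_dominated.
rewrite [leRHS]mulrCA ler_wpM2l// (le_trans (ler_normD _ _))//.
rewrite mulrDr !normrM !(mulrC B) lerD// ler_wpM2l//.
  exact: fourier_sin_le.
exact: fourier_cos_le.
Qed.

Lemma integrable_dz_pairing m f U : 7 / 2 < m -> intR leb5 f -> measurable_fun [set: mR5 R] U ->
  (sobolev_weighted m U < +oo)%E -> intR leb5 (dz_pairing f U).
Proof.
move=> hm fi mU wU.
apply: (@integrableR_le _ _ _ leb5 (fun xi => 2 * pi * (\int[leb5]_x `|f x|) *
  (bessel_weight (- (m - 1)) xi + 2^-1 * weighted_sqr m U xi))).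
- exact: measurable_dz_pairing.
- apply: integrableRZ; apply: integrableRD.
    by apply: integrable_bessel_weight; lra.
  by apply: integrableRZ; exact: sobolev_weighted_integrable.
- by move=> xi; exact: dz_pairing_le.
Qed.

(** The summand 1/2 in the constant is the AM-GM factor times the squared norm of U, which is at
    most 1. *)
Lemma Rintegral_dz_pairing_le m f U : 7 / 2 < m -> intR leb5 f -> measurable_fun [set: mR5 R] U ->
  (sobolev_weighted m U <= 1)%E ->
  `|\int[leb5]_xi (dz_pairing f U xi)| <=
  2 * pi * (\int[leb5]_xi (bessel_weight (- (m - 1)) xi) + 2^-1) * \int[leb5]_x `|f x|.
Proof.
move=> hm fi mU wU; have wU' : (sobolev_weighted m U < +oo)%E := le_lt_trans wU (ltry 1).
have ip := integrable_dz_pairing hm fi mU wU'.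
have ib : intR leb5 (bessel_weight (- (m - 1))) by apply: integrable_bessel_weight; lra.
have iw := sobolev_weighted_integrable mU wU'.
have iz := integrableRZ 2^-1 iw.
have is_ := integrableRD ib iz.
apply: (le_trans (le_normr_Rintegral measurableT ip)).
apply: (@le_trans _ _ (\int[leb5]_xi (2 * pi * (\int[leb5]_x `|f x|) *
  (bessel_weight (- (m - 1)) xi + 2^-1 * weighted_sqr m U xi)))).
  apply: le_Rintegral => //; first exact: integrableR_norm.
    exact: integrableRZ.
  by move=> xi _; exact: dz_pairing_le.
rewrite RintegralZl// RintegralD// RintegralZl// [leRHS]mulrAC ler_wpM2l//.
  by rewrite !mulr_ge0 ?pi_ge0//; apply: Rintegral_ge0.
by rewrite lerD2l ler_piMr// sobolev_weighted_le1.
Qed.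

(** Makes the pairing a function of u alone, whichever transform of u is used. *)
Lemma Rintegral_dz_pairing_ae f U V : intR leb5 f ->
  measurable_fun [set: mR5 R] U -> measurable_fun [set: mR5 R] V ->
  {ae leb5, forall xi, U xi = V xi} ->
  \int[leb5]_xi (dz_pairing f U xi) = \int[leb5]_xi (dz_pairing f V xi).
Proof.
move=> fi mU mV UV; congr fine; apply: ae_eq_integral => //.
- by apply/measurable_EFinP; exact: measurable_dz_pairing.
- by apply/measurable_EFinP; exact: measurable_dz_pairing.
- by apply: ae_imply UV => xi e _; rewrite /dz_pairing e.
Qed.

End sobolev.

(** * The pairing on test functions *)

Section test_pairing.
Variable R : realType.
Local Notation leb5 := (leb5 R).
Local Notation ez := ((0, 1) : R5 R).

(** The finite weighted norm makes the transform of d_z phi, which is 2 pi i xi_z phi^, integrable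
    by [bessel_dominated]. That is the hypothesis needed to apply [parseval] to f and d_z phi. *)
Lemma Rintegral_dz_pairing_test (m : R) (f phi : R5 R -> R) U : 7 / 2 < m -> intR leb5 f ->
  test_function phi -> phi \in Lfun leb5 2%:E -> is_fourier_L2 phi U ->
  (sobolev_weighted m U < +oo)%E ->
  \int[leb5]_xi (dz_pairing f U xi) = - \int[leb5]_x (f x * 'D_ez phi x).
Proof.
move=> hm fi tphi phiL hU wU.
have mphi : measurable_fun [set: mR5 R] phi by move: phiL; rewrite inE => /andP[]; rewrite !inE.
have [[M phiM] [B phiB]] := test_function_bounded ez tphi.
have iphi : intR leb5 phi.
  apply: (@integrable_bounded_support _ _ M B) => // x; first exact: (phiB x).1.
  by move=> px; apply: phiM; left.
have dphi x : derivable phi x ez := (tphi.1 [::]).2 x ez.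
have cphi : continuous phi := (tphi.1 [::]).1.
have cD : continuous ('D_ez phi) := (tphi.1 [:: ez]).1.
have iD : intR leb5 ('D_ez phi).
  apply: (@integrable_bounded_support _ _ M B) => //.
  - exact: measurable_derive.
  - by move=> x; exact: (phiB x).2.
  - by move=> x px; apply: phiM; right.
(* The integral formula also gives an L^2 transform of phi, so by uniqueness it may replace U. *)
have hV : is_fourier_L2 phi (fourier_L1 phi).
  apply: (fourier_L2_of_bounded_support (N := Num.sqrt (5 * M ^+ 2))) => // x px.
  by apply: norm5_le_coord5; apply: phiM; left.
have UV := fourier_L2_unique phiL hU hV.
have mU := hU.1; have mV := hV.1.
rewrite (Rintegral_dz_pairing_ae fi mU mV UV).
rewrite (sobolev_weighted_ae m mU mV UV) in wU.
have out x : M < `|x.2| -> phi x = 0 /\ 'D_ez phi x = 0.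
  move=> xM; split; apply: contrapT => /eqP px; move: xM; rewrite ltNge => /negP; apply.
    by apply: (phiM x _ (@Ordinal 5 4 isT)); left.
  by apply: (phiM x _ (@Ordinal 5 4 isT)); right.
have FD xi := fourier_derive_ez xi iphi iD dphi cphi cD out.
pose dom xi := 2 * pi * (bessel_weight (- (m - 1)) xi + 2^-1 * weighted_sqr m (fourier_L1 phi) xi).
have idom : intR leb5 dom.
  apply: integrableRZ; apply: integrableRD.
    by apply: integrable_bessel_weight; lra.
  by apply: integrableRZ; exact: sobolev_weighted_integrable.
have pi0 : 0 <= 2 * pi :> R by rewrite mulr_ge0// pi_ge0.
have domle xi : 2 * pi * (`|xi.2| * (`|fourier_cos phi xi| + `|fourier_sin phi xi|)) <= dom xi.
  by rewrite ler_wpM2l//; have := bessel_dominated m (fourier_L1 phi) xi; rewrite /= normrN.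
have mD := integrableR_measurable iD.
have ic : intR leb5 (fourier_cos ('D_ez phi)).
  apply: (@integrableR_le _ _ _ leb5 dom) => //; first exact: measurable_fourier_cos.
  move=> xi; rewrite (FD xi).1 (le_trans _ (domle xi))// normrM (normrM (2 * pi)) (ger0_norm pi0).
  by rewrite -(mulrA (2 * pi)) ler_wpM2l// ler_wpM2l// lerDr.
have is_ : intR leb5 (fourier_sin ('D_ez phi)).
  apply: (@integrableR_le _ _ _ leb5 dom) => //; first exact: measurable_fourier_sin.
  move=> xi; rewrite (FD xi).2 (le_trans _ (domle xi))// normrN normrM (normrM (2 * pi)) (ger0_norm pi0).
  by rewrite -(mulrA (2 * pi)) ler_wpM2l// ler_wpM2l// lerDl.
rewrite (parseval fi iD (fun x => (phiB x).2) cD ic is_).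
have mf := integrableR_measurable fi.
pose h xi := fourier_cos f xi * fourier_cos ('D_ez phi) xi +
  fourier_sin f xi * fourier_sin ('D_ez phi) xi.
have ih : intR leb5 h.
  apply: integrableRD.
    under eq_fun do rewrite mulrC.
    apply: (integrableRM (M := \int[leb5]_x `|f x|)) => //; first exact: measurable_fourier_cos.
    by move=> xi; exact: fourier_cos_le.
  under eq_fun do rewrite mulrC.
  apply: (integrableRM (M := \int[leb5]_x `|f x|)) => //; first exact: measurable_fourier_sin.
  by move=> xi; exact: fourier_sin_le.
have e : \int[leb5]_xi (- 1 * h xi) = - 1 * \int[leb5]_xi (h xi) := RintegralZl (- 1) measurableT ih.
rewrite -[RHS]mulN1r -[RHS]e; apply: eq_Rintegral => xi _.
by rewrite /h (FD xi).1 (FD xi).2 /dz_pairing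
  -[(fourier_L1 phi xi).1]/(fourier_cos phi xi) -[(fourier_L1 phi xi).2]/(- fourier_sin phi xi); ring.
Qed.

End test_pairing.

(** * The extension to H^m and its dual norm *)

Theorem lemma7p3 (R : realType) (m : R) (hm : 7 / 2 < m) :
  exists C : R, forall F : R5 R -> R,
    radial F -> compactly_supported F ->
    (fun x => F x ^+ 2) \in Lfun (@leb5 R) 1%E ->
    (neg_sobolev_norm m (distr_dz (regular_distribution (fun x => (F x ^+ 2)%R)))
     <= C%:E * Lnorm (@leb5 R) 1 (fun x => (F x ^+ 2)%:E))%E.
Proof.
(* The constant of [Rintegral_dz_pairing_le]; it involves m only. *)
pose C := 2 * pi * (\int[leb5 R]_xi (bessel_weight (- (m - 1)) xi) + 2^-1).
exists C => F _ _ FL.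
pose f x := F x ^+ 2; rewrite -/f in FL *.
have fi : intR (leb5 R) f by exact: (Lfun1_integrable _ _).1 FL.
set T := distr_dz _.
(* On H^m, L is the pairing with a chosen transform, and [LE] frees it from the choice. Elsewhere L
   is set to T, so agreement with T there holds by construction. *)
have [L [LE LT]] : exists L : (R5 R -> R) -> R,
    (forall u U, sobolev m u -> is_fourier_L2 u U -> L u = \int[leb5 R]_xi (dz_pairing f U xi)) /\
    (forall u, ~ sobolev m u -> L u = T u).
  pose uhat (u : R5 R -> R) := xget (fun=> (0, 0)) [set U | is_fourier_L2 u U].
  exists (fun u => if pselect (sobolev m u) then \int[leb5 R]_xi (dz_pairing f (uhat u) xi) else T u).
  split=> [u U su hU|u nu]; case: pselect => //= _.
  have hu : is_fourier_L2 u (uhat u).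
    exact: (@xgetI _ (fun=> (0, 0)) [set U | is_fourier_L2 u U] U).
  apply: (Rintegral_dz_pairing_ae fi hu.1 hU.1); exact: fourier_L2_unique su.1 hu hU.
have Lnorm_f : Lnorm (leb5 R) 1 (fun x => (F x ^+ 2)%:E) = (\int[leb5 R]_x `|f x|)%:E.
  rewrite Lnorm1 /Rintegral fineK//.
  by apply: integrable_fin_num => //; exact: integrableR_norm.
rewrite Lnorm_f -EFinM.
apply: (@le_trans _ _ (dual_norm m L)); last first.
  apply: ge_ereal_sup => _ [u [su nu] <-]; rewrite lee_fin.
  (* The same choice as in [sobolev_norm], so the hypothesis [nu] is a bound on V. *)
  pose V := xget (fun=> (0, 0)) [set U | is_fourier_L2 u U].
  have hV : is_fourier_L2 u V.
    by case: su => _ [U hU _]; exact: (@xgetI _ (fun=> (0, 0)) [set U | is_fourier_L2 u U] U).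
  rewrite (LE u V su hV); exact: (Rintegral_dz_pairing_le hm fi hV.1 nu).
(* It remains to see that L competes in the infimum: linearity on H^m, then agreement with T on test
   functions. *)
apply: ereal_inf_lbound; exists L => //; split.
  move=> a u v su sv.
  have [uL [U hU wU]] := su; have [vL [V hV wV]] := sv.
  have hW := fourier_L2_lincomb a uL vL hU hV.
  have sw : sobolev m (fun x => a * u x + v x).
    split; first exact: Lfun2_lincomb.
    exact: (ex_intro2 _ _ _ hW (sobolev_weighted_lincomb a hU.1 hV.1 wU wV)).
  have iU := integrable_dz_pairing hm fi hU.1 wU.
  have iV := integrable_dz_pairing hm fi hV.1 wV.
  rewrite (LE _ _ sw hW) (LE _ _ su hU) (LE _ _ sv hV).
  rewrite -(RintegralZl a measurableT iU) -(RintegralD measurableT (integrableRZ a iU) iV).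
  by apply: eq_Rintegral => xi _; rewrite /dz_pairing /=; ring.
move=> phi tphi; have [sphi|nphi] := pselect (sobolev m phi); last exact: LT.
have [phiL [U hU wU]] := sphi.
by rewrite (LE _ _ sphi hU) (Rintegral_dz_pairing_test hm fi tphi phiL hU wU).
Qed.
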